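(* Let $\alpha\in(0,2)$ and $\gamma\in(0,\infty)$, and let $H_{\alpha,\gamma}$ be the $\alpha$-heavy Marčenko–Pastur law. If $u>0$, then $H_{\alpha,\gamma}(\{u\})=0$.
   Context: Let $\xi$ be a real random variable that is symmetric ($\xi$ and $-\xi$ have the same law) and regularly varying with index $\alpha$: $\mathbb{P}(|\xi|>x)=x^{-\alpha}L(x)$ for $x>0$, where $L:(0,\infty)\to(0,\infty)$ is slowly varying at infinity, i.e. $L(tx)/L(x)\to1$ as $x\to\infty$ for every $t>0$. For i.i.d. copies $X_{ij}$ ($i,j\ge1$) of $\xi$, let $Y_{ij}=X_{ij}/\sqrt{X_{i1}^2+\cdots+X_{in}^2}$, $\mathbf{Y}_n=(Y_{ij})_{1\le i\le p,1\le j\le n}$, and let $\mathbf{R}_n=\mathbf{Y}_n\mathbf{Y}_n^\top$ be the $p\times p$ sample correlation matrix. The $\alpha$-heavy Marčenko–Pastur law $H_{\alpha,\gamma}$ is the deterministic probability measure on $[0,\infty)$ that is the almost sure weak limit, as $n\to\infty$ with $p=p_n\to\infty$, $p/n\to\gamma$, of the empirical spectral distributions $\frac1p\sum_{i=1}^p\delta_{\lambda_i(\mathbf{R}_n)}$; its existence (and the fact that it depends only on $\alpha,\gamma$) is a known result of Heiny and Yao, and may be assumed. *)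

(* Defs.v *)
From HB Require Import structures.
From mathcomp Require Import all_boot all_order all_algebra.
From mathcomp Require Import sesquilinear spectral.
From mathcomp Require complex.
From mathcomp Require Import all_classical all_reals all_analysis.

Set Implicit Arguments.
Unset Strict Implicit.
Unset Printing Implicit Defensive.
Import Order.TTheory GRing.Theory Num.Theory.
Import numFieldNormedType.Exports.
Local Open Scope classical_set_scope.
Local Open Scope ring_scope.

(* The eigenvalues in nondecreasing order, with algebraic multiplicity; by
   [spectrum_symmetric] the default value [::] is never used when A is
   symmetric. *)
Definition spectrum (R : realType) m (A : 'M[R]_m) : seq R :=
  xget [::] [set s | sorted <=%O s /\
                     char_poly A = \prod_(x <- s) ('X - x%:P)].

Section spectrum_symmetric.
Import complex.
Variable R : realType.

Lemma char_poly_conj (F : fieldType) m (P D : 'M[F]_m) : P \in unitmx ->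
  char_poly (invmx P *m D *m P) = char_poly D.
Proof.
move=> Pu; rewrite /char_poly.
set P' := map_mx (@polyC F) P; set Q' := map_mx (@polyC F) (invmx P).
have QP : Q' *m P' = 1%:M.
  by rewrite /Q' /P' -map_mxM mulVmx// map_scalar_mx/= polyC1.
have -> : char_poly_mx (invmx P *m D *m P) = Q' *m char_poly_mx D *m P'.
  rewrite /char_poly_mx mulmxBr mulmxBl !map_mxM; congr (_ - _).
  by rewrite scalar_mxC -mulmxA QP mulmx1.
by rewrite !det_mulmx mulrAC -det_mulmx QP det1 mul1r.
Qed.

Lemma spectrum_symmetric m (A : 'M[R]_m) : A^T = A ->
  [/\ size (spectrum A) = m, sorted <=%O (spectrum A) &
      char_poly A = \prod_(x <- spectrum A) ('X - x%:P)].
Proof.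
move=> symA; pose B : 'M[R[i]]_m := map_mx (real_complex R) A.
have Bherm : B \is hermsymmx.
  apply: realsym_hermsym.
    by apply/is_hermitianmxP; rewrite scale1r map_mx_id// /B map_trmx symA.
  by apply/mxOverP => i j; rewrite mxE complex_real.
have [s As] : exists s : seq R, char_poly A = \prod_(x <- s) ('X - x%:P).
  have /orthomx_spectralP BE := hermitian_normalmx Bherm.
  have /mxOverP dR := hermitian_spectral_diag_real Bherm.
  exists [seq complex.Re (spectral_diag B 0 i) | i <- enum 'I_m].
  apply: (map_poly_inj (real_complex R)).
  rewrite map_char_poly -/B BE char_poly_conj ?spectral_unit//.
  rewrite char_poly_trig ?diag_mx_is_trig// big_map rmorph_prod big_enum/=.
  apply: eq_bigr => i _; rewrite rmorphB/= map_polyX map_polyC/= mxE eqxx mulr1n.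
  congr ('X - _%:P); rewrite -BE; exact/esym/(RRe_real (dR 0 i)).
have [srt sE] : [set s | sorted <=%O s /\
    char_poly A = \prod_(x <- s) ('X - x%:P)] (spectrum A).
  apply: (@xgetI _ _ _ (sort <=%O s)); split; first exact: sort_le_sorted.
  by rewrite As; apply: perm_big; rewrite perm_sym perm_sort.
split=> //; have := size_char_poly A; rewrite sE size_prod_XsubC.
by case.
Qed.

End spectrum_symmetric.

(* (1/m) times the sum of the Dirac masses at the eigenvalues; the total mass
   is 1 when m > 0 and A is symmetric *)
Definition esd (R : realType) m (A : 'M[R]_m) :
    {measure set (measurableTypeR R) -> \bar R} :=
  mscale (m%:R^-1)%:nng
    (msum (fun k => \d_((spectrum A)`_k : measurableTypeR R)) m).

(* Only the entries x i j with i < p and j < n are used; indices start at 0. *)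
Definition self_normalized (R : realType) (p n : nat) (x : nat -> nat -> R) :
    'M[R]_(p, n) :=
  \matrix_(i < p, j < n) (x i j / Num.sqrt (\sum_(k < n) x i k ^+ 2)).

Definition sample_correlation (R : realType) (p n : nat) (x : nat -> nat -> R) :
    'M[R]_p :=
  self_normalized p n x *m (self_normalized p n x)^T.

Lemma sample_correlation_sym (R : realType) p n (x : nat -> nat -> R) :
  (sample_correlation p n x)^T = sample_correlation p n x.
Proof. by rewrite /sample_correlation trmx_mul trmxK. Qed.

Definition weak_cvg (R : realType)
    (mu : nat -> {measure set (measurableTypeR R) -> \bar R})
    (nu : {measure set (measurableTypeR R) -> \bar R}) :=
  forall f : R -> R, continuous f -> (exists M : R, forall x, `|f x| <= M) ->
    (\int[mu n]_x (f x)%:E)%E @[n --> \oo] --> (\int[nu]_x (f x)%:E)%E.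

Section random_variables.
Variables (R : realType) (d : measure_display) (T : measurableType d).
Variable P : probability T R.

(* Laws are compared on measurable sets only, since measures are unconstrained
   outside the sigma-algebra. *)
Definition symmetric_rv (xi : {RV P >-> R}) :=
  forall B : set R, measurable B -> P (xi @^-1` B) = P ((fun w => - xi w) @^-1` B).

Definition slowly_varying (L : R -> R) :=
  forall t : R, 0 < t -> L (t * x) / L x @[x --> +oo] --> (1 : R).

Definition regularly_varying_rv (alpha : R) (xi : {RV P >-> R}) :=
  exists L : R -> R, [/\ forall x, 0 < x -> 0 < L x, slowly_varying L &
    forall x, 0 < x ->
      P [set w | x < `|xi w|] = (x `^ (- alpha) * L x)%:E].

Definition independent_array (X : nat -> nat -> {RV P >-> R}) :=
  forall (s : seq (nat * nat)) (B : nat * nat -> set R), uniq s ->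
    (forall k, measurable (B k)) ->
    P (\bigcap_(k in [set` s]) (X k.1 k.2 @^-1` B k)) =
    (\prod_(k <- s) P (X k.1 k.2 @^-1` B k))%E.

Definition iid_copies (xi : {RV P >-> R}) (X : nat -> nat -> {RV P >-> R}) :=
  independent_array X /\
  forall i j (B : set R), measurable B ->
    P (X i j @^-1` B) = P (xi @^-1` B).

End random_variables.

(* H is the almost sure weak limit of the empirical spectral distributions for
   every entry law, every probability space and every sequence of dimensions
   allowed by (alpha, gamma). This determines H. *)
Definition heavy_Marchenko_Pastur (R : realType) (alpha gamma : R)
    (H : probability (measurableTypeR R) R) :=
  H [set x | 0 <= x] = 1%E /\
  forall (d : measure_display) (T : measurableType d) (P : probability T R)
    (xi : {RV P >-> R}) (X : nat -> nat -> {RV P >-> R}) (p : nat -> nat),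
    symmetric_rv xi -> regularly_varying_rv alpha xi -> iid_copies xi X ->
    p n @[n --> \oo] --> \oo ->
    (p n)%:R / n%:R @[n --> \oo] --> gamma ->
    {ae P, forall w,
      weak_cvg (fun n => esd (sample_correlation (p n) n (fun i j => X i j w)))
        H}.

(* Main.v *)
(** Suppose H({u}) = h > 0.  H may be tested on a single entry law, chosen here
    as the integer-valued symmetric Pareto law P(|xi| >= m) = m^-alpha, so that
    every event about finitely many entries is a countable union of atoms.

    Let F(C) = eta^2 ((C - u)^2 + eta^2)^-1, the smoothed spectral projection of
    C at u.  By weak convergence tr F(R_n) >= (h/2) p with probability at least
    1/2 for large n.  Remove row i from Y_n, and let B_i be the n x n Gram matrix
    of the other rows.  Then F(R_n)_ii <= C eta^2 |X_i|^2 / Q_i, where X_i is the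
    i-th row of raw entries and Q_i = X_i^T F(B_i) X_i.  An atom of R_n at u is
    also one of the n x n Gram matrix, hence, up to a bounded error, of B_i:
    tr F(B_i) is at least of order n and a positive fraction of the diagonal
    entries of F(B_i) exceeds some kappa > 0.  Among the corresponding entries
    X_ij one is of order n^(1/alpha) with probability close to 1, and as a
    function of such an X_ij the nonnegative quadratic form Q_i is small only on
    a short interval, while |X_i|^2 is of order n^(2/alpha) since alpha < 2.
    So all diagonal entries F(R_n)_ii are small with probability close to 1, which
    contradicts the lower bound on the trace. *)

Require Import Defs.
From HB Require Import structures.
From mathcomp Require Import all_boot all_order all_algebra.
From mathcomp Require Import sesquilinear spectral.
From mathcomp Require complex.
From mathcomp Require Import all_classical all_reals all_analysis.
From mathcomp Require Import measurable_realfun.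
From mathcomp Require Import ring lra zify.

Set Implicit Arguments.
Unset Strict Implicit.
Unset Printing Implicit Defensive.
Import Order.TTheory GRing.Theory Num.Theory.
Import numFieldNormedType.Exports.
Local Open Scope classical_set_scope.
Local Open Scope ring_scope.

(** * Smoothed spectral projections *)

Section dot_product.
Variable R : realFieldType.

Definition dot n (x y : 'cV[R]_n) : R := (x^T *m y) 0 0.

Lemma dotE n (x y : 'cV[R]_n) : dot x y = \sum_k x k 0 * y k 0.
Proof. by rewrite /dot mxE; apply: eq_bigr => k _; rewrite mxE. Qed.

Lemma dotC n (x y : 'cV[R]_n) : dot x y = dot y x.
Proof. by rewrite !dotE; apply: eq_bigr => k _; rewrite mulrC. Qed.

Lemma dotDr n (x y z : 'cV[R]_n) : dot x (y + z) = dot x y + dot x z.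
Proof. by rewrite /dot mulmxDr mxE. Qed.

Lemma dotZr n a (x y : 'cV[R]_n) : dot x (a *: y) = a * dot x y.
Proof. by rewrite /dot -scalemxAr mxE. Qed.

Lemma dotNr n (x y : 'cV[R]_n) : dot x (- y) = - dot x y.
Proof. by rewrite /dot mulmxN mxE. Qed.

Lemma dotDl n (x y z : 'cV[R]_n) : dot (y + z) x = dot y x + dot z x.
Proof. by rewrite dotC dotDr !(dotC x). Qed.

Lemma dotZl n a (x y : 'cV[R]_n) : dot (a *: y) x = a * dot y x.
Proof. by rewrite dotC dotZr (dotC x). Qed.

Lemma dotNl n (x y : 'cV[R]_n) : dot (- y) x = - dot y x.
Proof. by rewrite dotC dotNr (dotC x). Qed.

Lemma dot_mulmxr m n (A : 'M[R]_(m, n)) x y :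
  dot x (A *m y) = dot (A^T *m x) y.
Proof. by rewrite /dot trmx_mul trmxK mulmxA. Qed.

Lemma dotxx_ge0 n (x : 'cV[R]_n) : 0 <= dot x x.
Proof. by rewrite dotE sumr_ge0// => k _; rewrite -expr2 sqr_ge0. Qed.

Lemma dotxx_eq0 n (x : 'cV[R]_n) : dot x x <= 0 -> x = 0.
Proof.
move=> x0; have {x0}: dot x x == 0 by rewrite eq_le x0 dotxx_ge0.
rewrite dotE psumr_eq0; last by move=> k _; rewrite -expr2 sqr_ge0.
move=> /allP x0; apply/matrixP => k j; rewrite ord1 mxE.
by have := x0 k (mem_index_enum _); rewrite /= -expr2 sqrf_eq0 => /eqP.
Qed.

Lemma dot_young n (x y : 'cV[R]_n) c : 0 < c ->
  2 * `|dot x y| <= c * dot x x + c^-1 * dot y y.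
Proof.
move=> c0; have cn : c != 0 by rewrite gt_eqF.
have key s : s * s = 1 -> 0 <= c * dot x x + c^-1 * dot y y + 2 * s * dot x y.
  move=> s1; have := dotxx_ge0 (c *: x + s *: y).
  rewrite dotDr !dotDl !dotZr !dotZl (dotC y x) => h.
  rewrite -(pmulr_rge0 _ c0); apply: le_trans h _; rewrite le_eqVlt; apply/orP.
  left; apply/eqP.
  have -> : s * (s * dot y y) = dot y y by rewrite mulrA s1 mul1r.
  by field.
have k1 := key 1 (mulr1 _); have k2 := key (-1) (etrans (mulrNN 1 1) (mulr1 1)).
by case: (ger0P (dot x y)) => _; lra.
Qed.

Lemma dot_cauchy n (x y : 'cV[R]_n) : dot x y ^+ 2 <= dot x x * dot y y.
Proof.
have [x0|x0] := ltP 0 (dot x x); last first.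
  by rewrite (dotxx_eq0 x0) /dot trmx0 !mul0mx mxE expr0n mul0r.
have := dotxx_ge0 (dot x x *: y - dot x y *: x).
rewrite dotDr !dotDl !dotNr !dotNl !dotZr !dotZl (dotC y x).
rewrite -(pmulr_rge0 _ x0) => h; rewrite -subr_ge0.
rewrite -(pmulr_rge0 _ x0) -(pmulr_rge0 _ x0); apply: le_trans h _.
by rewrite le_eqVlt; apply/orP; left; apply/eqP; ring.
Qed.

Lemma mx_entryE m n (A : 'M[R]_(m, n)) i j :
  A i j = dot (delta_mx i 0) (A *m delta_mx j 0).
Proof. by rewrite /dot trmx_delta mulmxA -rowE -colE !mxE. Qed.

Lemma mxtrace_dyad n (A : 'M[R]_n) (x y : 'cV[R]_n) :
  \tr (A *m (x *m y^T)) = dot y (A *m x).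
Proof.
rewrite mulmxA mxtrace_mulC mulmxA -mulmxA /dot /mxtrace big_ord1.
by rewrite mulmxA.
Qed.

End dot_product.

(** * A Lorentzian function of a symmetric matrix *)

Section lorentz.
Variable R : realFieldType.
Variables u eta : R.
Hypotheses (eta0 : 0 < eta).

Definition shifted_square n (C : 'M[R]_n) : 'M[R]_n :=
  (C - u%:M) *m (C - u%:M) + (eta ^+ 2)%:M.

(** For symmetric [C] this is [eta] times the imaginary part of the resolvent of [C] at [u + i eta],
    written without complex numbers. *)
Definition lorentz n (C : 'M[R]_n) : 'M[R]_n :=
  eta ^+ 2 *: invmx (shifted_square C).

Lemma shifted_squareE n (C : 'M[R]_n) (x : 'cV[R]_n) : C^T = C ->
  dot x (shifted_square C *m x) =
  dot ((C - u%:M) *m x) ((C - u%:M) *m x) + eta ^+ 2 * dot x x.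
Proof.
move=> Cs; rewrite mulmxDl dotDr mul_scalar_mx dotZr -mulmxA dot_mulmxr.
by rewrite linearB /= tr_scalar_mx Cs.
Qed.

(** The matrix is positive definite: on a kernel vector the form of [shifted_squareE] vanishes, and
    it dominates [eta ^+ 2] times the squared norm. *)
Lemma shifted_square_unit n (C : 'M[R]_n) : C^T = C ->
  shifted_square C \in unitmx.
Proof.
move=> Cs; rewrite -unitmx_tr -row_free_unit -kermx_eq0; apply/eqP.
apply/row_matrixP => i; rewrite row0.
have /sub_kermxP : (row i (kermx (shifted_square C)^T) <= kermx (shifted_square C)^T)%MS.
  exact: row_sub.
set x := row i _ => xS; apply: trmx_inj; rewrite trmx0.
apply: dotxx_eq0; have := @shifted_squareE _ C x^T Cs.
have -> : shifted_square C *m x^T = 0.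
  by apply: trmx_inj; rewrite trmx_mul trmxK xS trmx0.
have e2 : 0 < eta ^+ 2 by rewrite exprn_gt0.
rewrite {1}/dot mulmx0 mxE => h; rewrite -(pmulr_rle0 _ e2).
by have := dotxx_ge0 ((C - u%:M) *m x^T); lra.
Qed.

Lemma shifted_square_tr n (C : 'M[R]_n) : C^T = C ->
  (shifted_square C)^T = shifted_square C.
Proof.
by move=> Cs; rewrite linearD /= trmx_mul linearB /= !tr_scalar_mx Cs.
Qed.

Lemma lorentz_tr n (C : 'M[R]_n) : C^T = C -> (lorentz C)^T = lorentz C.
Proof.
by move=> Cs; rewrite /lorentz linearZ /= trmx_inv shifted_square_tr.
Qed.

Lemma shifted_square_lorentz n (C : 'M[R]_n) : C^T = C ->
  shifted_square C *m lorentz C = (eta ^+ 2)%:M.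
Proof.
move=> Cs; rewrite -scalemxAr mulmxV ?shifted_square_unit//.
by rewrite scale_scalar_mx mulr1.
Qed.

Lemma lorentz_shifted_square n (C : 'M[R]_n) : C^T = C ->
  lorentz C *m shifted_square C = (eta ^+ 2)%:M.
Proof.
move=> Cs; rewrite -scalemxAl mulVmx ?shifted_square_unit//.
by rewrite scale_scalar_mx mulr1.
Qed.

(** Put [a = lorentz C *m x]. Then [shifted_square C *m a = eta ^+ 2 *: x], so the left side is the
    form of [shifted_square C] at [a]. *)
Lemma lorentz_dot n (C : 'M[R]_n) (x : 'cV[R]_n) : C^T = C ->
  eta ^+ 2 * dot x (lorentz C *m x) =
  dot ((C - u%:M) *m (lorentz C *m x)) ((C - u%:M) *m (lorentz C *m x)) +
  eta ^+ 2 * dot (lorentz C *m x) (lorentz C *m x).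
Proof.
move=> Cs; rewrite -shifted_squareE// mulmxA shifted_square_lorentz//.
by rewrite mul_scalar_mx dotZr dotC.
Qed.

Lemma lorentz_dot_ge0 n (C : 'M[R]_n) (x : 'cV[R]_n) : C^T = C ->
  0 <= dot x (lorentz C *m x).
Proof.
move=> Cs; have e2 : 0 < eta ^+ 2 by rewrite exprn_gt0.
by rewrite -(pmulr_rge0 _ e2) lorentz_dot// addr_ge0 ?mulr_ge0 ?dotxx_ge0// ltW.
Qed.

(** Matrix forms of [F <= 1], [F^2 <= F] and [|s| eta^2 / (s^2 + eta^2) <= eta / 2]. The last one
    combines [lorentz_dot] with [|x - 2 a|^2 >= 0]. *)
Lemma lorentz_contract n (C : 'M[R]_n) (x : 'cV[R]_n) : C^T = C ->
  let a := lorentz C *m x in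
  dot x a <= dot x x /\ dot a a <= dot x a /\
  4 * dot ((C - u%:M) *m a) ((C - u%:M) *m a) <= eta ^+ 2 * dot x x.
Proof.
move=> Cs a; have e2 : 0 < eta ^+ 2 by rewrite exprn_gt0.
have := lorentz_dot x Cs; rewrite -/a; set b := (_ - _) *m a => ha.
have b0 := dotxx_ge0 b.
have h1 : 0 <= dot x a - dot a a.
  by rewrite -(pmulr_rge0 _ e2) mulrBr; lra.
have h2 : 0 <= dot (x - a) (x - a) by exact: dotxx_ge0.
have h3 : 0 <= dot (x - 2 *: a) (x - 2 *: a) by exact: dotxx_ge0.
rewrite !(dotDr, dotDl, dotNr, dotNl, dotZl, dotZr) (dotC a x) in h2 h3.
split; [lra|split; first lra].
have -> : dot b b = eta ^+ 2 * (dot x a - dot a a) by rewrite mulrBr; lra.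
rewrite mulrCA ler_pM2l//; lra.
Qed.

Lemma lorentz_diag_le1 n (C : 'M[R]_n) i : C^T = C -> lorentz C i i <= 1.
Proof.
move=> Cs; rewrite mx_entryE; have [+ _] := lorentz_contract (delta_mx i 0) Cs.
by rewrite {2}/dot trmx_delta mul_delta_mx mxE !eqxx.
Qed.

Lemma lorentz_diag_ge0 n (C : 'M[R]_n) i : C^T = C -> 0 <= lorentz C i i.
Proof. by move=> Cs; rewrite mx_entryE lorentz_dot_ge0. Qed.

End lorentz.

(** * Gram matrices and the removal of one row *)

Section gram.
Variable R : realFieldType.
Variables u eta : R.
Hypotheses (u0 : 0 < u) (eta0 : 0 < eta).
Variables (p n : nat) (Y : 'M[R]_(p, n)).

Let L m (C : 'M[R]_m) := lorentz u eta C.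

(** The row is zeroed and not deleted, so that the format stays fixed; the Gram matrix of the
    columns is the same in both cases. *)
Definition zero_row m k (Z : 'M[R]_(m, k)) (i : 'I_m) : 'M[R]_(m, k) :=
  \matrix_(l, j) if l == i then 0 else Z l j.

Lemma gram_sym m k (Z : 'M[R]_(m, k)) : (Z *m Z^T)^T = Z *m Z^T.
Proof. by rewrite trmx_mul trmxK. Qed.

Lemma gramT_sym m k (Z : 'M[R]_(m, k)) : (Z^T *m Z)^T = Z^T *m Z.
Proof. by rewrite trmx_mul trmxK. Qed.

Lemma zero_rowE (i : 'I_p) :
  zero_row Y i = Y - delta_mx i 0 *m row i Y.
Proof.
apply/matrixP => l j; rewrite !mxE big_ord1 !mxE eqxx andbT.
by case: eqP => [->|_]; rewrite ?mul1r ?subrr// mul0r subr0.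
Qed.

Lemma zero_row_tr_mul k (i : 'I_p) (X : 'M[R]_(p, k)) :
  (zero_row Y i)^T *m X = Y^T *m X - (row i Y)^T *m row i X.
Proof.
rewrite zero_rowE linearB /= trmx_mul trmx_delta mulmxBl; congr (_ - _).
by rewrite -mulmxA -rowE.
Qed.

Lemma gram_zero_row (i : 'I_p) :
  (zero_row Y i)^T *m zero_row Y i = Y^T *m Y - (row i Y)^T *m row i Y.
Proof.
rewrite zero_row_tr_mul.
have -> : row i (zero_row Y i) = 0.
  by apply/rowP => j; rewrite !mxE eqxx.
rewrite mulmx0 subr0 zero_rowE mulmxBr; congr (_ - _).
by rewrite mulmxA -colE tr_row.
Qed.

(* A real form of |G_ii| = 1 / (|z| |1 + r^T (B - z)^-1 r|) for the resolvent G
   at z = u + i eta, where only the imaginary part of the denominator is kept.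
   In the proof, [a] is the i-th column of the smoothed projection and
   [v = Y^T a] an approximate eigenvector, which is tested against
   [y = F(B) r] after substitution in (B - u) v. *)
Lemma lorentz_row_bound (i : 'I_p) (r := (row i Y)^T) :
  u ^+ 2 * (L (Y *m Y^T) i i * dot r (L ((zero_row Y i)^T *m zero_row Y i) *m r))
  <= 4 * (u + eta) * eta ^+ 2.
Proof.
set A := Y *m Y^T; set B := _ *m zero_row Y i; set Y0 := zero_row Y i in B *.
have As : A^T = A by exact: gram_sym.
have Bs : B^T = B by exact: gramT_sym.
set a : 'cV_p := L A *m delta_mx i 0.
set y := L B *m r; set e := (A - u%:M) *m a; set v := Y^T *m a.
have Ae : A *m a = u *: a + e by rewrite /e mulmxBl mul_scalar_mx addrC subrK.
have aii : L A i i = a i 0 by rewrite /a -colE [RHS]mxE.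
have fa : eta ^+ 2 * L A i i = dot e e + eta ^+ 2 * dot a a.
  by rewrite mx_entryE (lorentz_dot u eta0 (delta_mx i 0) As).
have fy : eta ^+ 2 * dot r y =
    dot ((B - u%:M) *m y) ((B - u%:M) *m y) + eta ^+ 2 * dot y y.
  exact: (lorentz_dot u eta0 r Bs).
set F := L A i i in aii fa *; set rho := dot r y in fy *.
have F0 : 0 <= F by exact: lorentz_diag_ge0.
have rho0 : 0 <= rho by exact: lorentz_dot_ge0.
have e2 : 0 < eta ^+ 2 by rewrite exprn_gt0.
have en : eta != 0 by rewrite gt_eqF.
(* Young's inequality with weight [eta]. It controls the cross terms [dot a e] and
   [dot y ((B - u) y)] that arise in [vv] and [Y0y]. *)
have yv (x : R) m (w z : 'cV[R]_m) : dot w w + eta ^+ 2 * dot z z = eta ^+ 2 * x ->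
    dot z w <= eta * x.
  move=> h; have := dot_young z w eta0 => h1.
  have h2 : eta * dot z z + eta^-1 * dot w w = eta * x.
    by apply: (mulfI en); rewrite mulrDr mulVKf// !mulrA -expr2 addrC h.
  have := ler_norm (dot z w); have : 0 <= eta * x.
    by rewrite -h2 addr_ge0// mulr_ge0 ?invr_ge0 ?dotxx_ge0// ltW.
  lra.
have vv : dot v v <= (u + eta) * F.
  rewrite /v -dot_mulmxr mulmxA -/A Ae dotDr dotZr mulrDl lerD//.
    rewrite ler_pM2l//; rewrite -(ler_pM2l e2) fa.
    by rewrite lerDr dotxx_ge0.
  by apply: yv; rewrite fa.
have Y0y : dot (Y0 *m y) (Y0 *m y) <= (u + eta) * rho.
  rewrite dot_mulmxr dotC mulmxA -/B.
  have -> : B *m y = u *: y + (B - u%:M) *m y.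
    by rewrite mulmxBl mul_scalar_mx addrC subrK.
  rewrite dotDr dotZr mulrDl lerD//.
    rewrite ler_pM2l//; rewrite -(ler_pM2l e2) fy.
    by rewrite lerDr dotxx_ge0.
  by apply: yv; rewrite fy.
(* Here [B v = Y^T (A a) - (r^T v) r], with [A a = u a + e] and [r^T v = (A a)_i = u F + e_i]; the
   term [e_i r] changes [Y^T e] into [Y0^T e]. *)
have Bv : (B - u%:M) *m v = Y0^T *m e - (u * F) *: r.
  rewrite mulmxBl mul_scalar_mx /B gram_zero_row mulmxBl.
  rewrite -[Y^T *m Y *m v]mulmxA /v [Y *m (Y^T *m a)]mulmxA -/A Ae -/v.
  rewrite -mulmxA -/r; set q := row i Y *m v.
  have -> : q = (u * F + e i 0)%:M.
    apply/matrixP => k l; rewrite !ord1 [RHS]mxE eqxx mulr1n.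
    have -> : q 0 0 = (A *m a) i 0 by rewrite /q /A -mulmxA -row_mul mxE.
    by rewrite Ae !mxE aii mxE.
  rewrite /Y0 zero_row_tr_mul mul_mx_scalar -/r.
  have -> : r *m row i e = e i 0 *: r.
    rewrite -mul_mx_scalar; congr (_ *m _); apply/matrixP => k l.
    by rewrite !ord1 !mxE eqxx mulr1n.
  rewrite mulmxDr -scalemxAr scalerDl /v.
  by rewrite addrAC (addrC (u *: _)) addrK opprD addrA addrAC.
(* Pairing with [y] moves [B - u] onto [y], where [fy] controls it. *)
have key : u * F * rho = dot (Y0 *m y) e - dot ((B - u%:M) *m y) v.
  have -> : dot ((B - u%:M) *m y) v = dot y ((B - u%:M) *m v).
    by rewrite [RHS]dot_mulmxr linearB /= tr_scalar_mx Bs.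
  rewrite Bv dotDr dotNr dotZr [dot y r]dotC -/rho dot_mulmxr trmxK; ring.
set X1 := dot (Y0 *m y) e in key; set X2 := dot _ v in key.
have c1 : X1 ^+ 2 <= (u + eta) * rho * (eta ^+ 2 * F).
  apply: le_trans (dot_cauchy _ _) _; apply: ler_pM => //; rewrite ?dotxx_ge0//.
  by rewrite fa lerDl mulr_ge0 ?dotxx_ge0// ltW.
have c2 : X2 ^+ 2 <= (eta ^+ 2 * rho) * ((u + eta) * F).
  apply: le_trans (dot_cauchy _ _) _; apply: ler_pM => //; rewrite ?dotxx_ge0//.
  by rewrite fy lerDl mulr_ge0 ?dotxx_ge0// ltW.
(* From [(X1 - X2)^2 <= 2 X1^2 + 2 X2^2], where each square is at most [(u + eta) eta^2 F rho];
   hence the constant 4. Dividing by [F rho] leaves the claim. *)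
have c3 : (u * F * rho) ^+ 2 <= 4 * (u + eta) * eta ^+ 2 * (F * rho).
  rewrite key; have : 0 <= (X1 + X2) ^+ 2 by exact: sqr_ge0.
  rewrite !sqrrD !expr2 in c1 c2 *; lra.
have := mulr_ge0 F0 rho0; rewrite le_eqVlt => /predU1P[<-|Fr0].
  by rewrite mulr0 !mulr_ge0// ?addr_ge0// ltW.
rewrite -(ler_pM2r Fr0); apply: le_trans c3.
by rewrite le_eqVlt; apply/orP; left; apply/eqP; ring.
Qed.

Lemma lorentz_shift_diag m (C : 'M[R]_m) i : C^T = C ->
  2 * `|(L C *m (C - u%:M)) i i| <= eta.
Proof.
move=> Cs; rewrite mx_entryE.
have -> : dot (delta_mx i 0 : 'cV_m) (L C *m (C - u%:M) *m delta_mx i 0) =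
    dot (delta_mx i 0) ((C - u%:M) *m (L C *m delta_mx i 0)).
  rewrite -[in LHS]mulmxA 2!dot_mulmxr dotC lorentz_tr//.
  by rewrite linearB /= tr_scalar_mx Cs.
have [_ [_ h]] := lorentz_contract u eta0 (delta_mx i 0 : 'cV_m) Cs.
have d1 : dot (delta_mx i 0 : 'cV[R]_m) (delta_mx i 0) = 1.
  by rewrite /dot trmx_delta mul_delta_mx mxE !eqxx.
rewrite d1 mulr1 in h.
set w := (_ *m _) in h *; have c := dot_cauchy (delta_mx i 0 : 'cV[R]_m) w.
rewrite d1 mul1r in c.
rewrite -ler_sqr ?nnegrE ?mulr_ge0// ?(ltW eta0)//.
apply: le_trans h; rewrite exprMn real_normK ?num_real//.
by rewrite !expr2 in c *; lra.
Qed.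

Lemma lorentz_shift_trace m (C : 'M[R]_m) : C^T = C ->
  2 * `|\tr (L C *m (C - u%:M))| <= m%:R * eta.
Proof.
move=> Cs; rewrite -[2](@ger0_norm R)// -normrM mulr_sumr.
apply: le_trans (ler_norm_sum _ _ _) _.
rewrite -[m in leRHS]card_ord mulr_natl -sumr_const; apply: ler_sum => i _.
by rewrite normrM ger0_norm//; exact: lorentz_shift_diag.
Qed.

(* Both sides are compared through tr (A F(A)) = tr (M F(M)), where A = Y Y^T and
   M = Y^T Y. *)
Lemma lorentz_gram_trace :
  u * \tr (L (Y *m Y^T)) - (p + n)%:R * eta <= u * \tr (L (Y^T *m Y)).
Proof.
set A := Y *m Y^T; set M := Y^T *m Y.
have As : A^T = A by exact: gram_sym.
have Ms : M^T = M by exact: gramT_sym.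
(* [Y] intertwines [A - u] and [M - u], hence also their shifted squares and their smoothed
   projections. *)
have AY1 : (A - u%:M) *m Y = Y *m (M - u%:M).
  by rewrite mulmxBl mulmxBr /A /M mulmxA scalar_mxC.
have AY : shifted_square u eta A *m Y = Y *m shifted_square u eta M.
  by rewrite /shifted_square mulmxDl mulmxDr scalar_mxC -mulmxA AY1 !mulmxA AY1.
have LY : L A *m Y = Y *m L M.
  have e2 : eta ^+ 2 != 0 by rewrite gt_eqF// exprn_gt0.
  apply: (scalerI e2); rewrite -[LHS]mul_mx_scalar -[RHS]mul_scalar_mx.
  rewrite -(shifted_square_lorentz u eta0 Ms) -(lorentz_shifted_square u eta0 As).
  by rewrite -!mulmxA; congr (_ *m _); rewrite !mulmxA AY.
have trE m (C : 'M[R]_m) : \tr (L C *m C) = \tr (L C *m (C - u%:M)) + u * \tr (L C).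
  by rewrite mulmxBr linearB /= mul_mx_scalar linearZ /= subrK.
have : \tr (L A *m A) = \tr (L M *m M).
  by rewrite /A mulmxA LY -mulmxA mxtrace_mulC -mulmxA.
rewrite !trE natrD mulrDl.
have := lorentz_shift_trace As; have := lorentz_shift_trace Ms.
set x := \tr (L M *m (M - _)); set y := \tr (L A *m (A - _)).
have : 0 <= p%:R * eta by rewrite mulr_ge0// ltW.
have : 0 <= n%:R * eta by rewrite mulr_ge0// ltW.
have := ler_norm (- y); have := ler_norm x; rewrite normrN; lra.
Qed.

(** A rank-one change of the Gram matrix costs a trace bounded independently of the dimensions. The
    resolvent identity [E] expresses the difference through [SE], a sum of two rank-one matrices.
    Its trace is thus a sum of two inner products with [r], each at least [- eta]; division by
    [eta ^+ 2] gives [2 / eta]. *)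
Lemma lorentz_zero_row_trace (i : 'I_p) :
  dot (row i Y)^T (row i Y)^T <= 1 ->
  \tr (L (Y^T *m Y)) - 2 * eta^-1 <=
  \tr (L ((zero_row Y i)^T *m zero_row Y i)).
Proof.
set r := (row i Y)^T => r1.
set M := Y^T *m Y; set B := _ *m zero_row Y i.
have Ms : M^T = M by exact: gramT_sym.
have Bs : B^T = B by exact: gramT_sym.
have MB : M = B + r *m r^T by rewrite /B gram_zero_row /r trmxK subrK.
have e2 : 0 < eta ^+ 2 by rewrite exprn_gt0.
have en : eta != 0 by rewrite gt_eqF.
set a := L M *m r; set b := L B *m r.
have SE : shifted_square u eta M - shifted_square u eta B =
    (M - u%:M) *m (r *m r^T) + (r *m r^T) *m (B - u%:M).
  rewrite /shifted_square opprD addrACA subrr addr0.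
  have -> : r *m r^T = (M - u%:M) - (B - u%:M).
    rewrite MB; have key (V : zmodType) (x y z : V) : y = x + y - z - (x - z).
      by rewrite opprB addrA subrK addrAC subrr add0r.
    exact: key.
  move: (M - u%:M) (B - u%:M) => m b'.
  rewrite mulmxBr mulmxBl.
  have key (V : zmodType) (x y z : V) : x - z = x - y + (y - z).
    by rewrite addrA subrK.
  exact: key.
have E : eta ^+ 2 *: (L B - L M) =
    L M *m (shifted_square u eta M - shifted_square u eta B) *m L B.
  rewrite mulmxBr mulmxBl lorentz_shifted_square// -mulmxA shifted_square_lorentz//.
  by rewrite mul_scalar_mx mul_mx_scalar scalerBr.
have T : eta ^+ 2 * (\tr (L B) - \tr (L M)) =
    dot r ((M - u%:M) *m (L M *m b)) + dot r ((B - u%:M) *m (L B *m a)).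
  rewrite -linearB /= -linearZ /= E SE mulmxDr mulmxDl linearD /=.
  congr (_ + _).
    rewrite mxtrace_mulC.
    have -> : L B *m (L M *m ((M - u%:M) *m (r *m r^T))) =
        L B *m L M *m (M - u%:M) *m (r *m r^T) by rewrite !mulmxA.
    rewrite mxtrace_dyad dot_mulmxr dotC 2!trmx_mul.
    rewrite lorentz_tr// lorentz_tr// linearB /= tr_scalar_mx Ms.
    by rewrite /b !mulmxA.
  rewrite -mulmxA mxtrace_mulC.
  have -> : r *m r^T *m (B - u%:M) *m L B *m L M =
      r *m r^T *m ((B - u%:M) *m L B *m L M) by rewrite !mulmxA.
  by rewrite mxtrace_mulC mxtrace_dyad /a !mulmxA.
have [_ [_ ha]] := lorentz_contract u eta0 a Bs.
have [_ [_ hb]] := lorentz_contract u eta0 b Ms.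
have na : dot a a <= dot r r.
  by have [+ [+ _]] := lorentz_contract u eta0 r Ms; rewrite -/a; lra.
have nb : dot b b <= dot r r.
  by have [+ [+ _]] := lorentz_contract u eta0 r Bs; rewrite -/b; lra.
have key (x w : 'cV[R]_n) : dot x x <= dot r r ->
    4 * dot w w <= eta ^+ 2 * dot x x -> - eta <= dot r w.
  move=> xr wx; have := dot_young r w eta0.
  have h : eta^-1 * dot w w <= eta.
    rewrite -(ler_pM2l eta0) mulVKf// -expr2.
    have : eta ^+ 2 * dot x x <= eta ^+ 2 * 1 by rewrite ler_pM2l//; lra.
    lra.
  have h2 : eta * dot r r <= eta * 1 by rewrite ler_pM2l.
  have := ler_norm (- dot r w); rewrite normrN; lra.
rewrite -(ler_pM2l e2) mulrBr.
have -> : eta ^+ 2 * (2 * eta^-1) = 2 * eta by field.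
have := key _ _ na ha; have := key _ _ nb hb; rewrite mulrBr in T; lra.
Qed.
End gram.

(** * Link with the empirical spectral distribution *)

Definition lorentzian (R : realType) (u eta x : R) : R :=
  eta ^+ 2 / ((x - u) ^+ 2 + eta ^+ 2).

Section trace.
Import complex.
Variables (R : realType) (u eta : R).
Hypothesis eta0 : 0 < eta.

(** Diagonalization takes place over [R[i]], where the real symmetric matrix is Hermitian and its
    eigenvalues are real. *)
Lemma lorentz_trace m (A : 'M[R]_m) : A^T = A ->
  \tr (lorentz u eta A) = \sum_(k < m) lorentzian u eta (spectrum A)`_k.
Proof.
move=> symA; have [szA _ chA] := spectrum_symmetric symA.
pose rc := real_complex R; pose B : 'M[R[i]]_m := map_mx rc A.
have Bherm : B \is hermsymmx.
  apply: realsym_hermsym.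
    by apply/is_hermitianmxP; rewrite scale1r map_mx_id// /B map_trmx symA.
  by apply/mxOverP => i j; rewrite mxE complex_real.
have /orthomx_spectralP BE := hermitian_normalmx Bherm.
have /mxOverP dR := hermitian_spectral_diag_real Bherm.
set P := spectralmx B in BE; set D := spectral_diag B in BE dR.
have Pu : P \in unitmx := spectral_unit B.
pose e i := complex.Re (D 0 i).
have eD i : rc (e i) = D 0 i by exact: (RRe_real (dR 0 i)).
have chE : char_poly A = \prod_(x <- [seq e i | i <- enum 'I_m]) ('X - x%:P).
  apply: (map_poly_inj rc).
  rewrite map_char_poly -/B BE char_poly_conj//.
  rewrite char_poly_trig ?diag_mx_is_trig// big_map rmorph_prod big_enum/=.
  apply: eq_bigr => i _; rewrite rmorphB/= map_polyX map_polyC/= mxE eqxx mulr1n.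
  by congr ('X - _%:P); rewrite -eD.
have pe : perm_eq (spectrum A) [seq e i | i <- enum 'I_m].
  by apply/prod_XsubC_eq; rewrite -chA chE.
have -> : \sum_(k < m) lorentzian u eta (spectrum A)`_k = \sum_i lorentzian u eta (e i).
  transitivity (\sum_(x <- spectrum A) lorentzian u eta x).
    by rewrite (big_nth 0) szA big_mkord.
  by rewrite (perm_big _ pe) big_map big_enum.
pose D' := \row_i rc (lorentzian u eta (e i)).
have rcpos x : (x - u) ^+ 2 + eta ^+ 2 != 0.
  by rewrite gt_eqF// ltr_wpDl ?sqr_ge0// exprn_gt0.
pose E := diag_mx (\row_i (D 0 i - rc u)).
have BuE : map_mx rc (A - u%:M) = invmx P *m E *m P.
  rewrite map_mxB -/B BE map_scalar_mx.
  have -> : E = diag_mx D - (rc u)%:M.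
    apply/matrixP => i j; rewrite !mxE; case: eqP => _; rewrite ?mulr1n ?mulr0n//.
    by rewrite subrr.
  rewrite mulmxBr mulmxBl; congr (_ - _).
  by rewrite scalar_mxC -mulmxA mulVmx// mulmx1.
(* The candidate [P^-1 D' P] for the function of [A] is recognized through its product with the
   shifted square. *)
have SE : map_mx rc (shifted_square u eta A) *m (invmx P *m diag_mx D' *m P) =
    (rc (eta ^+ 2))%:M.
  rewrite map_mxD map_mxM BuE map_scalar_mx.
  have PE X Y : (invmx P *m X *m P) *m (invmx P *m Y *m P) =
      invmx P *m (X *m Y) *m P.
    by rewrite !mulmxA mulmxK.
  have cE (c : R[i]) : c%:M = invmx P *m c%:M *m P.
    by rewrite scalar_mxC -mulmxA mulVmx// mulmx1.
  rewrite PE [X in _ + X]cE -mulmxDl -mulmxDr PE [RHS]cE; congr (_ *m _ *m _).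
  rewrite mulmx_diag -!diag_const_mx -linearD /= mulmx_diag; congr diag_mx.
  apply/rowP => j; rewrite !mxE -eD -rmorphB -!rmorphM -rmorphD -rmorphM /=.
  by congr rc; rewrite /lorentzian -expr2 mulrC divfK.
have LE : map_mx rc (lorentz u eta A) = invmx P *m diag_mx D' *m P.
  have := congr1 (map_mx rc) (lorentz_shifted_square u eta0 symA).
  rewrite map_mxM map_scalar_mx => LS.
  have e2 : rc (eta ^+ 2) != 0 by rewrite fmorph_eq0 gt_eqF// exprn_gt0.
  apply: (scalerI e2); rewrite -[RHS]mul_scalar_mx -[X in _ = X *m _]LS.
  by rewrite -[RHS]mulmxA SE mul_mx_scalar.
apply: (fmorph_inj rc); rewrite -trace_map_mx LE mxtrace_mulC mulmxA mulmxV// mul1mx.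
rewrite mxtrace_diag rmorph_sum; apply: eq_bigr => i _; by rewrite mxE.
Qed.

End trace.

Lemma integral_esd (R : realType) m (A : 'M[R]_m) (f : R -> R) :
  continuous f -> (forall x, 0 <= f x) ->
  (\int[esd A]_x (f x)%:E = (m%:R^-1 * \sum_(k < m) f (spectrum A)`_k)%:E)%E.
Proof.
move=> cf f0; rewrite /esd.
have mf : measurable_fun setT (EFin \o (f : measurableTypeR R -> R)).
  by apply/measurable_EFinP; exact: continuous_measurable_fun.
rewrite ge0_integral_mscale//=; last by move=> x _; rewrite lee_fin.
rewrite ge0_integral_measure_sum//; last by move=> x _; rewrite lee_fin.
rewrite EFinM; congr (_ * _)%E.
rewrite -sumEFin; apply: eq_bigr => k _.
by rewrite integral_dirac// diracT mul1e.
Qed.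

(** * An i.i.d. sequence with a given discrete law *)

Section affine_preimage.
Variables (R : realType) (a p : R).
Local Notation T := (measurableTypeR R).

Definition affine (x : R) : R := (x - a) / p.

Lemma measurable_affine : measurable_fun [set: T] (affine : T -> T).
Proof.
apply: measurable_funM; last exact: measurable_cst.
by apply: measurable_funB; [exact: measurable_id|exact: measurable_cst].
Qed.

Lemma measurable_affine_preimage (B : set T) : measurable B ->
  measurable (affine @^-1` B : set T).
Proof. by move=> mB; rewrite -[X in measurable X]setTI; exact: measurable_affine. Qed.

Definition affine_lebesgue : set T -> \bar R :=
  fun B => lebesgue_measure (affine @^-1` B : set T).

Let affine0 : affine_lebesgue set0 = 0%E.
Proof. by rewrite /affine_lebesgue preimage_set0 measure0. Qed.

Let affine_ge0 B : (0 <= affine_lebesgue B)%E.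
Proof. exact: measure_ge0. Qed.

Let affine_sigma_additive : semi_sigma_additive affine_lebesgue.
Proof.
move=> F mF tF mUF; rewrite /affine_lebesgue preimage_bigcup.
apply: measure_semi_sigma_additive.
- by move=> n; exact: measurable_affine_preimage.
- apply/trivIsetP => /= i j _ _ ij; rewrite -preimage_setI.
  by move/trivIsetP : tF => /(_ _ _ _ _ ij) ->//; rewrite preimage_set0.
- by rewrite -preimage_bigcup; exact: measurable_affine_preimage.
Qed.

HB.instance Definition _ := isMeasure.Build _ _ _ affine_lebesgue
  affine0 affine_ge0 affine_sigma_additive.

(** Uniqueness of Lebesgue measure: [p^-1] times the pushforward [affine_lebesgue] gives every
    half-open interval its length. *)
Lemma lebesgue_affine_preimage (B : set T) : 0 < p -> measurable B ->
  lebesgue_measure (affine @^-1` B : set T) = (p%:E * lebesgue_measure B)%E.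
Proof.
move=> p0 mB; have ip : 0 <= p^-1 by rewrite invr_ge0 ltW.
rewrite [in RHS](@lebesgue_measure_unique R (mscale (NngNum ip) affine_lebesgue))//.
  by rewrite /= /mscale/= muleA -EFinM divff ?gt_eqF// mul1e.
move=> _ [[c d] _ <-]; rewrite /= /mscale/= /affine_lebesgue.
have -> : affine @^-1` `]c, d] = `](c * p + a), (d * p + a)]%classic.
  apply/seteqP; split => x /=; rewrite !in_itv/= /affine ltr_pdivlMr//;
    by rewrite ler_pdivrMr// ltrBrDr lerBlDr.
rewrite !lebesgue_measure_itv/= !lte_fin ltrD2r ltr_pM2r//.
case: ifP => _; rewrite ?mule0// -!EFinD -EFinM; congr EFin.
by field; rewrite gt_eqF.
Qed.

End affine_preimage.

Section unit_lebesgue.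
Variable R : realType.
Local Notation T := (measurableTypeR R).

(** The sample space is the whole line with all its mass on []0, 1]], so maps on it matter only
    there. The left-open interval matches the partition used by [digit]. *)
Definition unit_lebesgue : set T -> \bar R :=
  mrestr lebesgue_measure (measurable_itv `](0 : R), 1]).
HB.instance Definition _ := Measure.on unit_lebesgue.

Lemma unit_lebesgue_setT : unit_lebesgue setT = 1%E.
Proof.
by rewrite /unit_lebesgue /mrestr setTI lebesgue_measure_itv/= lte01 -EFinB subr0.
Qed.
HB.instance Definition _ :=
  Measure_isProbability.Build _ _ _ unit_lebesgue unit_lebesgue_setT.

End unit_lebesgue.

Section digits.
Variables (R : realType) (q : nat -> R).
Hypotheses (q0 : q 0%N = 1) (q_dec : forall k, q k.+1 < q k).
Hypothesis q_cvg : q n @[n --> \oo] --> (0 : R).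
Local Notation T := (measurableTypeR R).
Local Notation P := (@unit_lebesgue R).

(* [shift] maps each interval ](q k.+1), (q k)] affinely onto ]0, 1], so that it
   preserves Lebesgue measure and is independent of [digit]; iterating it gives
   i.i.d. digits. *)
Definition digit (x : T) : nat := xget 0%N [set k | q k.+1 < x <= q k].
Definition shift (x : T) : T :=
  affine (q (digit x).+1) (q (digit x) - q (digit x).+1) x.

Let q_le k l : (k <= l)%N -> q l <= q k.
Proof.
move=> /subnK <-; elim: (l - k)%N => [//|n ih]; rewrite addSn.
exact: le_trans (ltW (q_dec _)) ih.
Qed.

Let q_gt0 k : 0 < q k.
Proof.
apply: le_lt_trans (q_dec k); have <- : limn q = 0 by exact: cvg_lim.
by apply: nonincreasing_cvgn_ge; [exact: q_le|apply/cvg_ex; exists 0].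
Qed.

Lemma digitE k x : q k.+1 < x <= q k -> digit x = k.
Proof.
move=> xk; rewrite /digit; case: xgetP => [l -> /= xl|/(_ k)//].
have {}xk := xk; move: xk xl => /andP[k1 k2] /andP[l1 l2].
apply/eqP; rewrite eqn_leq; apply/andP; split; rewrite leqNgt; apply/negP.
  by move=> /q_le h; have := lt_le_trans k1 (le_trans l2 h); rewrite ltxx.
by move=> /q_le h; have := lt_le_trans l1 (le_trans k2 h); rewrite ltxx.
Qed.

Lemma digitP x : 0 < x <= 1 -> q (digit x).+1 < x <= q (digit x).
Proof.
move=> /andP[x0 x1].
have [n qn] : exists n, q n.+1 < x.
  have /cvgrPdist_lt/(_ _ x0)[n _ qn] := q_cvg.
  exists n; have := qn n.+1 (leqnSn n); rewrite /= sub0r normrN.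
  by rewrite ger0_norm ?(ltW (q_gt0 _)).
case: (ex_minnP (ex_intro (fun n => q n.+1 < x) n qn)) => k qk kmin.
have xk : q k.+1 < x <= q k.
  rewrite qk /=; case: k qk kmin => [|k] qk kmin; first by rewrite q0.
  by rewrite leNgt; apply/negP => /kmin; rewrite ltnn.
by rewrite (digitE xk).
Qed.

Lemma digit_out x : ~ (0 < x <= 1) -> digit x = 0%N.
Proof.
move=> nx; rewrite /digit; case: xgetP => // k _ /= /andP[k1 k2].
exfalso; apply: nx; rewrite (lt_trans (q_gt0 _) k1)/= (le_trans k2)//.
by rewrite -q0 q_le.
Qed.

Lemma measurable_digit (B : set nat) : measurable (digit @^-1` B).
Proof.
have -> : digit @^-1` B = \bigcup_(k in B) digit @^-1` [set k].
  apply/seteqP; split => [x Bx|x [k Bk] /= ->//].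
  by exists (digit x).
apply: bigcup_measurable => k _.
(* Outside []0, 1]] the default value of [digit] is 0, so the fibre over 0 also contains that
   complement. *)
have -> : digit @^-1` [set k] =
    `](q k.+1), (q k)]%classic `|` (if k == 0%N then ~` `]0, 1]%classic else set0).
  apply/seteqP; split => x /=; rewrite in_itv/=.
    have [x01 <-|nx] := pselect (0 < x <= 1); first by left; exact: digitP.
    by rewrite digit_out// => <-; right => /=; rewrite in_itv/=; exact: nx.
  move=> [/digitE//|]; case: eqP => [->|//] /=; rewrite in_itv/=.
  by move=> nx; exact: digit_out.
apply: measurableU; first exact: measurable_itv.
case: ifP => // _; apply: measurableC; exact: measurable_itv.
Qed.

Lemma measurable_shift : measurable_fun setT shift.
Proof.
move=> _ E mE; rewrite setTI.
have -> : shift @^-1` E = \bigcup_k (digit @^-1` [set k] `&`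
    affine (q k.+1) (q k - q k.+1) @^-1` E).
  apply/seteqP; split => [x Ex|x [k _ [/= <-]]//].
  by exists (digit x).
apply: bigcup_measurable => k _; apply: measurableI; first exact: measurable_digit.
exact: measurable_affine_preimage.
Qed.

Lemma digit_tail m : P (digit @^-1` [set i | (m <= i)%N]) = (q m)%:E.
Proof.
rewrite /= /unit_lebesgue /mrestr.
have -> : digit @^-1` [set i | (m <= i)%N] `&` `]0, 1]%classic = `]0, (q m)]%classic.
  apply/seteqP; split => x /=; rewrite !in_itv/=.
    move=> [mx x01]; have /andP[_ xq] := digitP x01.
    by case/andP: x01 => -> _ /=; rewrite (le_trans xq)// q_le.
  move=> /andP[x0 xm]; have x01 : 0 < x <= 1.
    by rewrite x0/= (le_trans xm)// -q0 q_le.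
  split => //; have /andP[xq _] := digitP x01.
  rewrite leqNgt; apply/negP => /q_le h.
  by have := lt_le_trans xq (le_trans xm h); rewrite ltxx.
by rewrite lebesgue_measure_itv/= lte_fin q_gt0 -EFinB subr0.
Qed.

(** On the [k]-th interval, of length [q k - q k.+1], [shift] is the affine bijection onto []0,
    1]]. *)
Let digit_shift1 k (E : set T) : measurable E ->
  P (digit @^-1` [set k] `&` shift @^-1` E) = ((q k - q k.+1)%:E * P E)%E.
Proof.
move=> mE; rewrite /= /unit_lebesgue /mrestr.
have pk : 0 < q k - q k.+1 by rewrite subr_gt0.
rewrite -(lebesgue_affine_preimage (q k.+1))//; last first.
  by apply: measurableI => //; exact: measurable_itv.
congr (lebesgue_measure _).
have affE x : (0 < affine (q k.+1) (q k - q k.+1) x <= 1) = (q k.+1 < x <= q k).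
  by rewrite /affine ltr_pdivlMr// mul0r subr_gt0 ler_pdivrMr// mul1r lerD2r.
apply/seteqP; split => x /=; rewrite !in_itv/=.
  move=> [[dx Ex] x01]; move: Ex; rewrite /shift dx => Ex; split => //.
  by rewrite affE -dx; exact: digitP.
move=> [Ex]; rewrite affE => xk; rewrite /shift (digitE xk); split => //.
move: xk => /andP[k1 k2]; rewrite (lt_trans (q_gt0 _) k1)/=.
by rewrite (le_trans k2)// -q0 q_le.
Qed.

Lemma digit_shift (B : set nat) (E : set T) : measurable E ->
  P (digit @^-1` B `&` shift @^-1` E) = (P (digit @^-1` B) * P E)%E.
Proof.
move=> mE.
have mS F : measurable F -> measurable (shift @^-1` F).
  by move=> mF; rewrite -[X in measurable X]setTI; exact: measurable_shift.
(* The factor [P F] does not depend on the digit and leaves the sum; taking [F = setT] identifies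
   the remaining sum as the probability that the digit lies in [B]. *)
have sumE (F : set T) : measurable F -> P (digit @^-1` B `&` shift @^-1` F) =
    (P F * \sum_(k <oo | k \in B) (q k - q k.+1)%:E)%E.
  move=> mF.
  have -> : digit @^-1` B `&` shift @^-1` F =
      \bigcup_(k in B) (digit @^-1` [set k] `&` shift @^-1` F).
    apply/seteqP; split => [x [Bx Fx]|x [k Bk] [/= dk Fx]].
      by exists (digit x).
    by split; rewrite //= dk.
  rewrite measure_bigcup/=; last 2 first.
  - by move=> k _; apply: measurableI; [exact: measurable_digit|exact: mS].
  - by move=> k l _ _ [x [[/= dk _] [/= dl _]]]; rewrite -dk -dl.
  rewrite -[P F]fineK ?fin_num_measure// -nneseriesZl; last first.
    by move=> k _; rewrite lee_fin subr_ge0 ltW.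
  by apply: eq_eseriesr => k _; rewrite fineK ?fin_num_measure// digit_shift1// muleC.
have := sumE setT measurableT; rewrite preimage_setT setIT => ->.
by rewrite sumE// probability_setT mul1e muleC.
Qed.

Definition digits k (x : T) := digit (iter k shift x).

Lemma measurable_iter_shift k : measurable_fun setT (iter k shift).
Proof.
elim: k => [|k ih]; first exact: measurable_id.
exact: measurableT_comp measurable_shift ih.
Qed.

Lemma measurable_digits k (B : set nat) : measurable (digits k @^-1` B).
Proof.
rewrite -[X in measurable X]setTI.
exact: (measurable_iter_shift k measurableT (measurable_digit B)).
Qed.

Lemma digits_law k (B : set nat) : P (digits k @^-1` B) = P (digit @^-1` B).
Proof.
elim: k => [//|k <-].
have -> : digits k.+1 @^-1` B = digit @^-1` setT `&` shift @^-1` (digits k @^-1` B).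
  by rewrite preimage_setT setTI; apply/seteqP; split => x; rewrite /= /digits iterSr.
rewrite digit_shift; last exact: measurable_digits.
by rewrite preimage_setT probability_setT mul1e.
Qed.

Lemma digits_indep N (B : nat -> set nat) :
  P (\bigcap_(k in `I_N) (digits k @^-1` B k)) =
  (\prod_(k < N) P (digit @^-1` B k))%E.
Proof.
elim: N B => [|N ih] B.
  by rewrite II0 bigcap_set0 big_ord0 probability_setT.
rewrite big_ord_recl -(ih (fun k => B k.+1)) -digit_shift; last first.
  by apply: bigcap_measurableType => k _; exact: measurable_digits.
congr (P _); apply/seteqP; split => x.
  move=> h; split; first exact: (h 0%N).
  by move=> k kN; have := h k.+1 kN; rewrite /= /digits iterSr.
move=> [h0 h] [|k] kN; first exact: h0.
by have := h k kN; rewrite /= /digits iterSr.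
Qed.

End digits.

(** * Conditioning on finitely many discrete variables *)

Section discrete_family.
Context d (T : measurableType d) (R : realType) (P : probability T R).
Variables (K : choiceType) (Z : K -> T -> nat).
Hypothesis mZ : forall k B, measurable (Z k @^-1` B).

Definition readout (s : seq K) (w : T) : seq nat := [seq Z k w | k <- s].

Lemma readout_fiber (s : seq K) v : uniq s -> size v = size s ->
  readout s @^-1` [set v] =
  \bigcap_(k in [set` s]) Z k @^-1` [set nth 0%N v (index k s)].
Proof.
move=> us sv; apply/seteqP; split => w /=.
  by move=> <- k /= ks; rewrite (nth_map k) ?index_mem// nth_index.
move=> h; apply: (@eq_from_nth _ 0%N); first by rewrite size_map sv.
move=> i; rewrite size_map => i_s.
have [k0 _] : exists k0 : K, True by case: (s) i_s => // k0; exists k0.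
have := h (nth k0 s i) (mem_nth _ i_s); rewrite /= index_uniq// => <-.
by rewrite (nth_map k0).
Qed.

Lemma readout_fiber0 (s : seq K) v : size v <> size s ->
  readout s @^-1` [set v] = set0.
Proof. by move=> sv; apply/seteqP; split => w //= h; apply: sv; rewrite -h size_map. Qed.

Lemma measurable_readout (s : seq K) (A : set (seq nat)) :
  measurable (readout s @^-1` A).
Proof.
have m1 v : measurable (readout s @^-1` [set v]).
  have [sv|sv] := pselect (size v = size s); last first.
    by rewrite readout_fiber0.
  have -> : readout s @^-1` [set v] = \bigcap_(i in [set i | (i < size s)%N])
      (if s is k0 :: _ then Z (nth k0 s i) @^-1` [set nth 0%N v i] else setT).
    apply/seteqP; split => w /=.
      move=> <- i /=; case: s sv => // k0 s _ i_s.
      by rewrite /readout (nth_map k0).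
    move=> h; apply: (@eq_from_nth _ 0%N); first by rewrite size_map sv.
    move=> i; rewrite size_map => i_s; have := h i i_s.
    by case: s sv h i_s => // k0 s _ h i_s <-; rewrite (nth_map k0).
  by apply: bigcap_measurableType => i _; case: s sv => [|k0 s] _; [exact: measurableT|exact: mZ].
have -> : readout s @^-1` A = \bigcup_(n in [set n | exists2 v, unpickle n = Some v & A v])
    readout s @^-1` [set odflt [::] (unpickle n)].
  apply/seteqP; split => w /=.
    move=> Aw; have [n nE] : exists n, unpickle n = Some (readout s w).
      by exists (pickle (readout s w)); rewrite pickleK.
    by exists n; [exists (readout s w)|exact: esym (congr1 (odflt [::]) nE)].
  move=> [n [v nv Av] h]; suff -> : readout s w = v by [].
  exact: etrans h (congr1 (odflt [::]) nv).
by apply: bigcup_measurable => n _; exact: m1.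
Qed.

(** Lists of naturals are countable, so an event determined by finitely many of the variables is a
    countable union of fibres. This covers events about spectral quantities without studying their
    measurability. *)
Lemma measurable_of_readout (s : seq K) (E : set T) :
  (forall w w', readout s w = readout s w' -> E w -> E w') -> measurable E.
Proof.
move=> h; have -> : E = readout s @^-1` (readout s @` E).
  apply/seteqP; split => w /=; first by move=> Ew; exists w.
  by move=> [w' Ew' e]; exact: h e Ew'.
exact: measurable_readout.
Qed.

(** Total probability over the countably many fibres, numbered by [pickle]. *)
Lemma measure_fiber_le (s : seq K) (E : set T) (e : R) : measurable E -> 0 <= e ->
  (forall w0, P (E `&` readout s @^-1` [set readout s w0]) <=
     e%:E * P (readout s @^-1` [set readout s w0]))%E ->
  (P E <= e%:E)%E.
Proof.
move=> mE e0 h; pose F n := (fun w => pickle (readout s w)) @^-1` [set n].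
have mF n : measurable (F n).
  exact: (measurable_readout s (pickle @^-1` [set n])).
have tF : trivIset setT F by move=> i j _ _ [w [/= <- <-]].
have EF (G : set T) : measurable G -> P G = (\sum_(n <oo) P (G `&` F n))%E.
  move=> mG; have {1}-> : G = \bigcup_n (G `&` F n).
    apply/seteqP; split => [w Gw|w [n _ []]//].
    by exists (pickle (readout s w)).
  rewrite measure_bigcup//.
  - by apply: eq_eseriesl => n; rewrite in_setT.
  - by move=> n _; exact: measurableI.
  - by move=> i j _ _ [w [[_ /= <-] [_ <-]]].
rewrite (EF E mE); apply: (@le_trans _ _ (\sum_(n <oo) e%:E * P (setT `&` F n))%E).
  apply: lee_nneseries => n _; first by move=> _; exact: measure_ge0.
  rewrite setTI; have [[w0 /= w0n]|Fn0] := pselect (F n !=set0).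
    have -> : F n = readout s @^-1` [set readout s w0]; last exact: h.
    apply/seteqP; split => w /=; rewrite /F /= -w0n; last by move=> ->.
    exact: (pcan_inj pickleK).
  have -> : F n = set0 by apply/seteqP; split => // w Fw; apply: Fn0; exists w.
  by rewrite setI0 measure0 mule0.
rewrite nneseriesZl// -(EF setT measurableT).
by rewrite probability_setT mule1.
Qed.

Hypothesis indep : forall (s : seq K) (B : K -> set nat), uniq s ->
  P (\bigcap_(k in [set` s]) Z k @^-1` B k) = (\prod_(k <- s) P (Z k @^-1` B k))%E.

(** One fibre of [readout s] is itself a product event, so independence can be applied to
    [s ++ t]. *)
Lemma indep_readout (s t : seq K) v (B : K -> set nat) : uniq (s ++ t) ->
  P (readout s @^-1` [set v] `&` \bigcap_(k in [set` t]) Z k @^-1` B k) =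
  (P (readout s @^-1` [set v]) * \prod_(k <- t) P (Z k @^-1` B k))%E.
Proof.
move=> ust; have := ust; rewrite cat_uniq => /and3P[us /hasPn st ut].
have [sv|sv] := pselect (size v = size s); last first.
  by rewrite readout_fiber0// set0I measure0 mul0e.
rewrite readout_fiber// indep//.
pose B' k := if k \in s then [set nth 0%N v (index k s)] else B k.
have -> : \bigcap_(k in [set` s]) Z k @^-1` [set nth 0%N v (index k s)] `&`
    \bigcap_(k in [set` t]) Z k @^-1` B k =
    \bigcap_(k in [set` s ++ t]) Z k @^-1` B' k.
  apply/seteqP; split => w /=.
    move=> [hs ht] k /=; rewrite mem_cat /B'.
    by case: ifPn => [ks _|ks /= kt]; [exact: hs|exact: ht].
  move=> h; split => k /= ks; have := h k; rewrite /= mem_cat ks ?orbT => /(_ erefl).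
    by rewrite /B' ks.
  by rewrite /B' (negbTE (st _ ks)).
rewrite indep// big_cat /=; congr (_ * _)%E.
  by rewrite !big_seq; apply: eq_bigr => k ks; rewrite /B' ks.
by rewrite !big_seq; apply: eq_bigr => k ks; rewrite /B' (negbTE (st _ ks)).
Qed.

(** Conditioning on the variables in [s]: the family [B] may depend on [w0], so the constraints on
    the variables in [t] may be selected by the observed values in [s]. *)
Lemma indep_slice (s t : seq K) (E : set T) (e : R) : uniq (s ++ t) ->
  measurable E -> 0 <= e ->
  (forall w0, exists2 B : K -> set nat,
     (forall w k, E w -> readout s w = readout s w0 -> k \in t -> B k (Z k w)) &
     (\prod_(k <- t) P (Z k @^-1` B k) <= e%:E)%E) ->
  (P E <= e%:E)%E.
Proof.
move=> ust mE e0 h; apply: (@measure_fiber_le s) => // w0.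
have [B EB Be] := h w0.
apply: (@le_trans _ _ (P (readout s @^-1` [set readout s w0] `&`
    \bigcap_(k in [set` t]) Z k @^-1` B k))).
  apply: le_measure; rewrite ?inE.
  - by apply: measurableI => //; exact: measurable_readout.
  - apply: measurableI; first exact: measurable_readout.
    by apply: fin_bigcap_measurable; [exact: finite_seq|move=> k _; exact: mZ].
  - by move=> w [Ew /= sw]; split => // k /= kt; exact: EB.
by rewrite indep_readout// muleC lee_wpmul2r// measure_ge0.
Qed.

End discrete_family.

Lemma markov_indicators d (T : measurableType d) (R : realType)
    (P : probability T R) (I : finType) (c : I -> R) (E : I -> set T)
    (G : set T) (t : R) :
  (forall i, 0 <= c i) -> (forall i, measurable (E i)) -> measurable G -> 0 <= t ->
  (forall w, G w -> t <= \sum_i c i * \1_(E i) w) ->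
  (t%:E * P G <= \sum_i (c i)%:E * P (E i))%E.
Proof.
move=> c0 mE mG t0 h.
have -> : (t%:E * P G)%E = (\int[P]_w (t * \1_G w)%:E)%E.
  under eq_integral do rewrite EFinM.
  rewrite ge0_integralZl//=; first by rewrite integral_indic// setIT.
  by apply/measurable_EFinP; exact: measurable_indic.
have -> : (\sum_i (c i)%:E * P (E i))%E = (\int[P]_w (\sum_i c i * \1_(E i) w)%:E)%E.
  under [RHS]eq_integral do rewrite -sumEFin.
  rewrite ge0_integral_sum//=.
  - apply: eq_bigr => i _; have ci := c0 i; under eq_integral do rewrite EFinM.
    rewrite ge0_integralZl//=; first by rewrite integral_indic// setIT.
    by apply/measurable_EFinP; exact: measurable_indic.
  - move=> i; apply/measurable_EFinP; apply: measurable_funM => //.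
  - by move=> i w _; rewrite lee_fin mulr_ge0.
apply: ge0_le_integral => //=.
- by move=> w ?; rewrite lee_fin mulr_ge0.
- by apply/measurable_EFinP; apply: measurable_funM => //; exact: measurable_indic.
- apply/measurable_EFinP; apply: measurable_sum => i.
  by apply: measurable_funM => //; exact: measurable_indic.
- move=> w ?; rewrite lee_fin; have [Gw|Gw] := pselect (G w).
    by rewrite indicE mem_set// mulr1; exact: h.
  by rewrite indicE memNset// mulr0 sumr_ge0// => i _; rewrite mulr_ge0.
Qed.

(** * The symmetric integer Pareto law *)

Section pareto.
Variables (R : realType) (alpha : R).
Hypothesis alpha0 : 0 < alpha.
Local Notation T := (measurableTypeR R).
Local Notation P := (@unit_lebesgue R).

(** The index is shifted by one: this is the probability that the absolute value is at least
    [l + 1]. *)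
Definition pareto_tail (l : nat) : R := l.+1%:R `^ (- alpha).

(* P(digit >= k): the digits 2l and 2l+1 are equally likely and stand for the
   values l+1 and -(l+1), see [signed_val]. *)
Definition pareto_cut (k : nat) : R :=
  if odd k then (pareto_tail k./2 + pareto_tail k./2.+1) / 2 else pareto_tail k./2.

Definition signed_abs (k : nat) : nat := k./2.+1.
Definition signed_val (k : nat) : R := (-1) ^+ odd k * (signed_abs k)%:R.

Lemma pareto_tail_lt l : pareto_tail l.+1 < pareto_tail l.
Proof.
rewrite /pareto_tail !powRN ltf_pV2 ?posrE ?powR_gt0//.
by apply: gt0_ltr_powR; rewrite ?nnegrE// ltr_nat.
Qed.

Lemma pareto_cut0 : pareto_cut 0 = 1.
Proof. by rewrite /pareto_cut/= /pareto_tail powR1. Qed.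

Lemma pareto_cut_lt k : pareto_cut k.+1 < pareto_cut k.
Proof.
rewrite /pareto_cut; rewrite -[k.+1./2]/(uphalf k) uphalf_half /=.
have := pareto_tail_lt k./2.
by case: (odd k) => /=; rewrite ?add0n ?add1n; lra.
Qed.

Lemma pareto_tail_cvg0 e : 0 < e -> exists N, forall l, (N <= l)%N -> pareto_tail l < e.
Proof.
move=> e0; exists (Num.truncn (e^-1 `^ alpha^-1)) => l Nl.
have e1 : e^-1 = (e^-1 `^ alpha^-1) `^ alpha.
  by rewrite -powRrM mulVf ?gt_eqF// powRr1// invr_ge0 ltW.
rewrite /pareto_tail powRN invf_plt ?posrE ?powR_gt0// e1.
apply: gt0_ltr_powR => //; rewrite ?nnegrE ?powR_ge0//.
by apply: lt_le_trans (truncnS_gt _) _; rewrite ler_nat.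
Qed.

Lemma pareto_cut_cvg : pareto_cut n @[n --> \oo] --> (0 : R).
Proof.
apply/cvgrPdist_lt => e e0; have [N hN] := pareto_tail_cvg0 e0.
exists N.*2 => // k /= Nk; rewrite sub0r normrN.
have Nk2 : (N <= k./2)%N by rewrite -[N]doubleK half_leq.
have := hN _ Nk2; have := pareto_tail_lt k./2.
have : 0 < pareto_tail k./2 by exact: powR_gt0.
have : 0 < pareto_tail k./2.+1 by exact: powR_gt0.
rewrite /pareto_cut; case: ifP => _ ? ? ? ?; rewrite gtr0_norm//; lra.
Qed.

Local Notation dig := (digit pareto_cut).
Local Notation digs := (digits pareto_cut).
Let H0 := pareto_cut0.
Let H1 := pareto_cut_lt.
Let H2 := pareto_cut_cvg.

Lemma signed_abs_law (m : nat) : (0 < m)%N ->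
  P (dig @^-1` [set k | (m <= signed_abs k)%N]) = (m%:R `^ (- alpha))%:E.
Proof.
move=> m0; have -> : [set k | (m <= signed_abs k)%N] = [set k | (m.-1.*2 <= k)%N].
  by apply/seteqP; split => k /=; rewrite /signed_abs; lia.
rewrite digit_tail// /pareto_cut odd_double doubleK /pareto_tail.
by rewrite prednK.
Qed.

Lemma digit_atom k : P (dig @^-1` [set k]) = (pareto_cut k - pareto_cut k.+1)%:E.
Proof.
have mD B := measurable_digit H0 H1 H2 B.
have : (P (dig @^-1` [set k]) + P (dig @^-1` [set i | (k < i)%N]) = (pareto_cut k)%:E)%E.
  rewrite -(digit_tail H0 H1 H2 k).
  have -> : [set i | (k <= i)%N] = [set k] `|` [set i | (k < i)%N].
    by apply/seteqP; split => i /=; lia.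
  rewrite preimage_setU [RHS]measureU//; last first.
    by apply/seteqP; split => // x [/= -> ]; rewrite ltnn.
rewrite digit_tail//.
have : P (dig @^-1` [set k]) \is a fin_num by rewrite fin_num_measure.
by case: (P _) => // r _; rewrite -EFinD => -[<-]; rewrite addrK.
Qed.

(** Negation exchanges the digits [2l] and [2l + 1], which have equal mass because the odd cut is
    the midpoint of two tails ([cutE]). *)
Lemma signed_val_symmetric (B : set R) :
  P (dig @^-1` (signed_val @^-1` B)) = P (dig @^-1` ((fun k => - signed_val k) @^-1` B)).
Proof.
have mD S := measurable_digit H0 H1 H2 S.
have split_law (S : set nat) : P (dig @^-1` S) =
    (\sum_(l <oo) P (dig @^-1` (S `&` [set k | k./2 = l])))%E.
  have {1}-> : dig @^-1` S = \bigcup_l (dig @^-1` (S `&` [set k | k./2 = l])).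
    by apply/seteqP; split => [x Sx|x [l _ []]//]; exists (dig x)./2.
  rewrite measure_bigcup//.
  - by apply: eq_eseriesl => l; rewrite in_setT.
  - by move=> i j _ _ [x [[_ /= <-] [_ /= <-]]].
rewrite !split_law; apply: eq_eseriesr => l _.
have atomE (S : set nat) k : P (dig @^-1` (S `&` [set k])) =
    if `[< S k >] then (pareto_cut k - pareto_cut k.+1)%:E else 0%E.
  case: asboolP => Sk; first by rewrite -digit_atom; congr (P (_ @^-1` _));
    apply/seteqP; split => [j []//|j ->].
  rewrite (_ : S `&` _ = set0) ?preimage_set0 ?measure0//.
  by apply/seteqP; split => // j [] /= + jk; rewrite jk.
have pairE (S : set nat) : P (dig @^-1` (S `&` [set k | k./2 = l])) =
    (P (dig @^-1` (S `&` [set l.*2])) + P (dig @^-1` (S `&` [set l.*2.+1])))%E.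
  rewrite -measureU//=; last first.
    by apply/seteqP; split => // x [[_ /= ->] [_ /=]]; lia.
  rewrite -preimage_setU -setIUr; congr (P (_ @^-1` (_ `&` _))).
  by apply/seteqP; split => k /=; lia.
have sv : signed_val l.*2.+1 = - signed_val l.*2.
  rewrite /signed_val /signed_abs /= odd_double /= expr1 expr0 mulN1r mul1r.
  by rewrite uphalf_double doubleK.
have cutE : pareto_cut l.*2.+1 - pareto_cut l.*2.+2 = pareto_cut l.*2 - pareto_cut l.*2.+1.
  rewrite /pareto_cut /= odd_double /= uphalf_double doubleK; lra.
rewrite !pairE !atomE cutE /= sv opprK addeC.
by [].
Qed.

Definition signed_digit k : T -> R := signed_val \o digs k.

Lemma measurable_signed_digit k : measurable_fun [set: T] (signed_digit k).
Proof.
move=> _ B mB; rewrite setTI.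
exact: (measurable_digits H0 H1 H2 k (signed_val @^-1` B)).
Qed.

HB.instance Definition _ k :=
  isMeasurableFun.Build _ _ _ _ (signed_digit k) (measurable_signed_digit k).

Definition pareto_rv k : {RV P >-> R} := [the {mfun T >-> R} of signed_digit k].

Definition pareto_array (i j : nat) : {RV P >-> R} := pareto_rv (pickle (i, j)).

Definition pareto_index (ij : nat * nat) : T -> nat := digs (pickle ij).

Lemma pareto_rv_symmetric k : symmetric_rv (pareto_rv k).
Proof.
move=> B mB.
apply: (etrans (digits_law H0 H1 H2 k (signed_val @^-1` B))).
apply: (etrans (signed_val_symmetric B)); apply/esym.
exact: (digits_law H0 H1 H2 k ((fun k => - signed_val k) @^-1` B)).
Qed.

Lemma norm_signed_val k : `|signed_val k| = (signed_abs k)%:R.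
Proof. by rewrite /signed_val normrM normrX normrN1 expr1n mul1r normr_nat. Qed.

Lemma digits_indep_seq (s : seq nat) (B : nat -> set nat) : uniq s ->
  P (\bigcap_(k in [set` s]) digs k @^-1` B k) =
  (\prod_(k <- s) P (digs k @^-1` B k))%E.
Proof.
move=> us; pose N := (\max_(k <- s) k).+1.
have sN k : k \in s -> (k < N)%N by move=> ks; rewrite ltnS; exact: (@leq_bigmax_seq _ s xpredT id).
pose B' k := if k \in s then B k else setT.
have -> : \bigcap_(k in [set` s]) digs k @^-1` B k =
    \bigcap_(k in `I_N) digs k @^-1` B' k.
  apply/seteqP; split => w h k /=.
    by rewrite /B'; case: ifPn => // ks _; exact: h.
  by move=> ks; have := h k (sN _ ks); rewrite /B' /= ks.
rewrite (digits_indep H0 H1 H2) -(big_mkord xpredT (fun k => P (dig @^-1` B' k))).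
transitivity (\prod_(0 <= k < N | k \in s) P (digs k @^-1` B k))%E.
  rewrite [RHS]big_mkcond; apply: eq_bigr => k _; rewrite /B'.
  by case: ifPn => _; rewrite ?preimage_setT ?probability_setT// (digits_law H0 H1 H2).
rewrite -big_filter; apply: perm_big; apply: uniq_perm => //.
  by rewrite filter_uniq// iota_uniq.
move=> k; rewrite mem_filter mem_index_iota /=.
by case: (boolP (k \in s)) => //= /sN.
Qed.

Lemma pareto_index_indep (s : seq (nat * nat)) (B : nat * nat -> set nat) : uniq s ->
  P (\bigcap_(k in [set` s]) pareto_index k @^-1` B k) =
  (\prod_(k <- s) P (pareto_index k @^-1` B k))%E.
Proof.
move=> us; pose B' n := odflt setT (omap B (unpickle n)).
have B'E k : B' (pickle k) = B k by rewrite /B' pickleK.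
have := digits_indep_seq B' (s := [seq pickle k | k <- s]).
rewrite (map_inj_uniq (pcan_inj pickleK)) => /(_ us).
rewrite big_map; under eq_bigr do rewrite B'E.
move=> <-; congr (P _); apply/seteqP; split => w h k /=.
  by move=> /mapP[k' k's ->]; rewrite B'E; exact: h.
by move=> ks; have := h (pickle k) (map_f _ ks); rewrite /= B'E.
Qed.

Lemma pareto_array_iid : iid_copies (pareto_rv 0) pareto_array.
Proof.
split=> [s B us mB|i j B mB]; last first.
  apply: (etrans (digits_law H0 H1 H2 _ (signed_val @^-1` B))).
  exact: (esym (digits_law H0 H1 H2 0 (signed_val @^-1` B))).
have := @pareto_index_indep s (fun k => signed_val @^-1` B k) us.
have pE k : pareto_index k @^-1` (signed_val @^-1` B k) = pareto_array k.1 k.2 @^-1` B k.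
  by case: k.
under eq_bigcapr do rewrite pE.
by under eq_bigr do rewrite pE.
Qed.

Lemma measurable_pareto_index k (B : set nat) : measurable (pareto_index k @^-1` B).
Proof. exact: measurable_digits H0 H1 H2 _ _. Qed.

Lemma pareto_index_law k (m : nat) : (0 < m)%N ->
  P (pareto_index k @^-1` [set i | (m <= signed_abs i)%N]) = (m%:R `^ (- alpha))%:E.
Proof. by move=> m0; rewrite (digits_law H0 H1 H2) signed_abs_law. Qed.

Hypothesis alpha2 : alpha < 2.

(** This is the slowly varying factor of [P(|xi| > x) = (truncn x + 1)^-alpha]. It equals [y^alpha]
    with [y = x / (truncn x + 1)]; for [x >= 1] one has [1 - 1/x <= y <= 1], and [alpha < 2] gives
    [y^alpha >= y^2 >= 1 - 2/x]. *)
Lemma truncn_tail_cvg : (fun x : R => x `^ alpha * (Num.truncn x).+1%:R `^ (- alpha)) x @[x --> +oo] --> (1 : R).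
Proof.
pose g (x : R) := x / (Num.truncn x).+1%:R.
have bound x : 1 <= x -> 1 - 2 / x <= x `^ alpha * (Num.truncn x).+1%:R `^ (- alpha) <= 1.
  move=> x1; have x0 : 0 < x by lra.
  set N : R := (Num.truncn x).+1%:R; have N0 : 0 < N by rewrite ltr0n.
  have xN : x < N by exact: truncnS_gt.
  have Nx : N <= x + 1 by rewrite /N -natr1 lerD2r truncn_le ltW.
  have -> : x `^ alpha * N `^ (- alpha) = (x / N) `^ alpha.
    rewrite powRM ?invr_ge0 ?ltW// powRN; congr (_ * _).
    by rewrite -[in RHS]powR_inv1 ?ltW// -powRrM mulN1r powRN.
  have g01 : 0 < x / N <= 1 by rewrite divr_gt0//= ler_pdivrMr// mul1r ltW.
  apply/andP; split.
    apply: (@le_trans _ _ ((x / N) `^ 2)); last by rewrite ger_powR// ltW.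
    rewrite powR_mulrn; last by case/andP: g01 => /ltW.
    have h : 1 - 1 / x <= x / N.
      rewrite ler_pdivlMr//.
      have h1 : N - x <= N / x.
        rewrite ler_pdivlMr//; have : (N - x) * x <= 1 * x by rewrite ler_pM2r//; lra.
        lra.
      have -> : (1 - 1 / x) * N = N - N / x by ring.
      lra.
    have z1 : 1 / x <= 1 by rewrite ler_pdivrMr// mul1r.
    have -> : 2 / x = 2 * (1 / x) by ring.
    move: h z1; set y := x / N; set z := 1 / x => h z1.
    have : 0 <= (y - (1 - z)) * (y + (1 - z)) by rewrite mulr_ge0//; lra.
    have := sqr_ge0 z; rewrite !expr2; lra.
  by rewrite -[leRHS](powRr0 (x / N)) ger_powR// ltW.
apply: (@squeeze_cvgr _ _ _ _ (fun x : R => 1 - 2 / x) (fun=> 1)).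
- near=> x; apply: bound; near: x; exact: nbhs_pinfty_ge.
- rewrite -[X in _ --> X]subr0; apply: cvgB; first exact: cvg_cst.
  rewrite -[X in _ --> X](mulr0 2); apply: cvgM; first exact: cvg_cst.
  apply/cvgrPdist_lt => e e0; near=> x.
  have x0 : 0 < x by near: x; exact: nbhs_pinfty_gt.
  rewrite sub0r normrN gtr0_norm ?invr_gt0// invf_plt//.
  by near: x; apply: nbhs_pinfty_gt; rewrite num_real.
- exact: cvg_cst.
Unshelve. all: by end_near. Qed.

Lemma pareto_rv_regularly_varying k : regularly_varying_rv alpha (pareto_rv k).
Proof.
exists (fun x => x `^ alpha * (Num.truncn x).+1%:R `^ (- alpha)); split.
- by move=> x x0; rewrite mulr_gt0// powR_gt0.
- move=> t t0; rewrite -[X in _ --> X](divr1 1); apply: cvgM; last first.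
    apply: cvgV; [exact: oner_neq0|exact: truncn_tail_cvg].
  apply: (cvg_comp _ _ _ truncn_tail_cvg).
  move=> A [M [_ MA]]; exists (M / t); split; first by rewrite num_real.
  by move=> x; rewrite ltr_pdivrMr// mulrC => /MA.
- move=> x x0; rewrite mulrA -powRD ?addNr ?eqxx ?gt_eqF// powRr0 mul1r.
  rewrite -signed_abs_law// -(digits_law H0 H1 H2 k); congr (P _).
  apply/seteqP; split => w /=; by rewrite norm_signed_val truncn_lt_nat// ltW.
Qed.

End pareto.

(** * Probability estimates for Pareto entries *)

Section power_estimates.
Variables (R : realType) (alpha : R).
Hypotheses (alpha0 : 0 < alpha) (alpha2 : alpha < 2).

(** Put [x = l + 1] and [z = b / x <= 2]. Then [(1 - 1/x)^b <= exp (-z) <= 1 / (1 + z)], and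
    [1 - 1 / (1 + z) = z / (1 + z) >= z / 3]. *)
Lemma powR_increment (l : nat) (b : R) : 0 < b -> b <= 2 ->
  b / 3 * (l.+1%:R `^ b / l.+1%:R) <= l.+1%:R `^ b - l%:R `^ b.
Proof.
move=> b0 b2; set x : R := l.+1%:R; have x0 : 0 < x by rewrite ltr0n.
have x1 : 1 <= x by rewrite ler1n.
set y := l%:R / x.
have y0 : 0 <= y by rewrite divr_ge0.
have yE : y = 1 - x^-1.
  by rewrite /y -[l%:R](addrK 1) natr1 mulrBl divff ?gt_eqF// mul1r.
have -> : l%:R `^ b = x `^ b * y `^ b.
  by rewrite -powRM ?(ltW x0)// /y mulrCA divff ?mulr1// gt_eqF.
have yb : y `^ b <= (1 + b / x)^-1.
  have d0 : 0 < 1 + b / x by rewrite ltr_wpDr// divr_ge0// ltW.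
  move: y0; rewrite le_eqVlt => /predU1P[<-|y0].
    by rewrite powR0 ?gt_eqF// invr_ge0 ltW.
  rewrite /powR gt_eqF//; apply: (@le_trans _ _ (expR (- (b / x)))).
    rewrite ler_expR -mulrN; apply: ler_wpM2l; first exact: ltW.
    rewrite -ler_expR lnK ?posrE// yE.
    exact: expR_ge1Dx.
  by rewrite expRN lef_pV2 ?posrE ?expR_gt0// expR_ge1Dx.
have xb0 : 0 < x `^ b by rewrite powR_gt0.
have bx : 0 <= b / x <= 2.
  rewrite (divr_ge0 (ltW b0) (ltW x0))/= ler_pdivrMr//; apply: (le_trans b2).
  by rewrite ler_peMr.
set z := b / x in yb bx.
have -> : b / 3 * (x `^ b / x) = x `^ b * (z / 3) by rewrite /z; ring.
rewrite -[X in X - _]mulr1 -mulrBr ler_pM2l//.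
apply: (@le_trans _ _ (1 - (1 + z)^-1)); last lra.
have z1 : 1 + z != 0 by rewrite gt_eqF//; lra.
have -> : 1 - (1 + z)^-1 = z / (1 + z) by field.
case/andP: bx => z0 z2; rewrite ler_wpM2l// lef_pV2 ?posrE; lra.
Qed.

(** By [sum_odd_min] the sum is the truncated second moment [E min(|xi|, t)^2]. Each term is
    compared with an increment of the power [2 - alpha], and the increments telescope. *)
Lemma pareto_second_moment (t : nat) :
  \sum_(l < t) (l.*2.+1)%:R * l.+1%:R `^ (- alpha) <=
  6 / (2 - alpha) * t%:R `^ (2 - alpha).
Proof.
have b0 : 0 < 2 - alpha by rewrite subr_gt0.
elim: t => [|t ih]; first by rewrite big_ord0 mulr_ge0 ?powR_ge0// divr_ge0// ltW.
rewrite big_ord_recr/=.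
have b2 : 2 - alpha <= 2 by rewrite gerBl ltW.
have := powR_increment t b0 b2.
have x0 : (0 : R) < t.+1%:R by rewrite ltr0n.
have -> : (t.+1%:R : R) `^ (2 - alpha) / t.+1%:R = t.+1%:R * t.+1%:R `^ (- alpha).
  rewrite powRD ?(gt_eqF x0) ?implybT// powR_mulrn ?ltW//; field.
  by rewrite gt_eqF.
set p := t.+1%:R `^ (- alpha).
have p0 : 0 <= p by rewrite powR_ge0.
set U := t.+1%:R `^ _ in ih *; set V := t%:R `^ _ in ih *.
move=> h; have {}h : 2 * (t.+1%:R * p) <= 6 / (2 - alpha) * (U - V).
  have -> : 2 * (t.+1%:R * p) = 6 / (2 - alpha) * ((2 - alpha) / 3 * (t.+1%:R * p)).
    by field; rewrite gt_eqF.
  by rewrite ler_wpM2l// divr_ge0// ltW.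
have h3 : (t.*2.+1)%:R * p <= 2 * (t.+1%:R * p).
  by rewrite mulrA ler_wpM2r// -natrM ler_nat; lia.
rewrite mulrBr in h; lra.
Qed.

(** The ratio of the two tails is [(N / (N + l))^alpha], which is at least
    [(N / (N + l))^2 >= 1 - 2 l / N] because [alpha < 2]. *)
Lemma pareto_tail_diff (N l : R) : 0 < N -> 0 <= l ->
  N `^ (- alpha) - (N + l) `^ (- alpha) <= 2 * l * (N `^ (- alpha) / N).
Proof.
move=> N0 l0; have Nl0 : 0 < N + l by lra.
have g01 : 0 < N / (N + l) <= 1 by rewrite divr_gt0//= ler_pdivrMr// mul1r; lra.
have -> : (N + l) `^ (- alpha) = N `^ (- alpha) * (N / (N + l)) `^ alpha.
  rewrite powRM ?invr_ge0 ?ltW// mulrA -powRD ?addNr ?eqxx ?gt_eqF// powRr0 mul1r.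
  by rewrite -[in RHS]powR_inv1 ?ltW// -powRrM mulN1r.
have h : (N / (N + l)) ^+ 2 <= (N / (N + l)) `^ alpha.
  rewrite -powR_mulrn; last by case/andP: g01 => /ltW.
  by rewrite ger_powR// ltW.
have h2 : 1 - 2 * l / N <= (N / (N + l)) ^+ 2.
  have e : N / (N + l) = 1 - l / (N + l) by field; rewrite gt_eqF.
  have : 0 <= (l / (N + l)) ^+ 2 by exact: sqr_ge0.
  have : l / (N + l) <= l / N by rewrite ler_wpM2l// lef_pV2 ?posrE//; lra.
  rewrite e; have -> : 2 * l / N = 2 * (l / N) by ring.
  set a := l / (N + l); set b := l / N; rewrite !expr2; lra.
have -> : 2 * l * (N `^ (- alpha) / N) = N `^ (- alpha) * (2 * l / N) by ring.
rewrite -[X in X - _]mulr1 -mulrBr ler_pM2l ?powR_gt0//; lra.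
Qed.

End power_estimates.

(** A layer-cake formula: it turns a truncated square into the weighted sum of indicators that
    [markov_indicators] requires. *)
Lemma sum_odd_min (R : realType) (a t : nat) :
  \sum_(l < t) (l.*2.+1)%:R * (l < a)%N%:R = (minn a t)%:R ^+ 2 :> R.
Proof.
elim: t => [|t ih]; first by rewrite big_ord0 minn0 expr0n.
rewrite big_ord_recr/= ih; case: ltnP => ta.
  rewrite (minn_idPr ta) mulr1 -!natrX -natrD; congr _%:R.
  by rewrite -[t.+1]addn1 sqrnD; lia.
by rewrite (minn_idPl (leqW ta)) mulr0 addr0.
Qed.

Section pareto_estimates.
Variables (R : realType) (alpha : R).
Hypotheses (alpha0 : 0 < alpha) (alpha2 : alpha < 2).
Context d (T : measurableType d) (P : probability T R).
Variables (K : choiceType) (Z : K -> T -> nat).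
Hypothesis mZ : forall k B, measurable (Z k @^-1` B).
Hypothesis lawZ : forall k (m : nat), (0 < m)%N ->
  P (Z k @^-1` [set i | (m <= signed_abs i)%N]) = (m%:R `^ (- alpha))%:E.

(** On the event, truncating the entries at [t] keeps the sum of squares at least [t^2]: one entry
    of size [t] suffices alone, and otherwise nothing is cut. Markov's inequality and the truncated
    second moment conclude. *)
Lemma sum_square_tail n (k : 'I_n -> K) (t : nat) : (0 < t)%N ->
  (P [set w | (t%:R ^+ 2 <= \sum_j (signed_abs (Z (k j) w))%:R ^+ 2 :> R)%R] <=
   (n%:R * (6 / (2 - alpha) * t%:R `^ (- alpha)))%:E)%E.
Proof.
move=> t0; set G := [set w | _].
have mG : measurable G.
  apply: (@measurable_of_readout _ _ _ Z mZ [seq k j | j <- enum 'I_n]) => w w' e.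
  have {}e j : Z (k j) w = Z (k j) w'.
    by move/eq_in_map : e; apply; rewrite map_f// mem_enum.
  by rewrite /G /=; under eq_bigr do rewrite e.
pose c (jl : 'I_n * 'I_t) : R := (jl.2.*2.+1)%:R.
pose E (jl : 'I_n * 'I_t) := Z (k jl.1) @^-1` [set i | (jl.2.+1 <= signed_abs i)%N].
have t2 : 0 <= (t%:R : R) ^+ 2 by exact: sqr_ge0.
have := @markov_indicators _ _ R P _ c E G (t%:R ^+ 2) (fun=> ler0n _ _)
  (fun jl => mZ _ _) mG t2.
have sumE w : \sum_i c i * \1_(E i) w =
    \sum_j (minn (signed_abs (Z (k j) w)) t)%:R ^+ 2.
  rewrite -(pair_bigA _ (fun j l => c (j, l) * \1_(E (j, l)) w))/=.
  apply: eq_bigr => j _; rewrite -sum_odd_min; apply: eq_bigr => l _.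
  by rewrite /c indicE; congr (_ * _%:R); congr nat_of_bool; apply/idP/idP; rewrite inE.
have h : forall w, G w -> t%:R ^+ 2 <= \sum_i c i * \1_(E i) w.
  move=> w Gw; rewrite sumE.
  have [[j tj]|h] := pselect (exists j, (t <= signed_abs (Z (k j) w))%N).
    rewrite (bigD1 j)//= (minn_idPr tj) lerDl sumr_ge0// => i _; exact: sqr_ge0.
  apply: (le_trans Gw); apply: ler_sum => j _; rewrite (minn_idPl _)//.
  by rewrite leqNgt; apply/negP => /ltnW tj; apply: h; exists j.
move=> /(_ h).
have -> : (\sum_i (c i)%:E * P (E i))%E =
    (n%:R * \sum_(l < t) (l.*2.+1)%:R * l.+1%:R `^ (- alpha))%:E.
  under eq_bigr do rewrite lawZ// -EFinM.
  rewrite sumEFin; congr EFin.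
  rewrite -(pair_bigA _ (fun (j : 'I_n) (l : 'I_t) => c (j, l) * l.+1%:R `^ (- alpha)))/=.
  by rewrite /c /= sumr_const card_ord mulr_natl.
have t2p : 0 < (t%:R : R) ^+ 2 by rewrite exprn_gt0// ltr0n.
have : P G \is a fin_num by rewrite fin_num_measure.
case: (P G) => // r _; rewrite -EFinM !lee_fin => le1.
rewrite -(ler_pM2l t2p); apply: (le_trans le1).
rewrite mulrCA; apply: ler_wpM2l => //.
apply: (le_trans (pareto_second_moment alpha0 alpha2 t)).
have tn : (t%:R : R) != 0 by rewrite pnatr_eq0 -lt0n.
rewrite powRD ?tn ?implybT//.
by rewrite powR_mulrn// mulrCA.
Qed.

Hypothesis indep : forall (s : seq K) (B : K -> set nat), uniq s ->
  P (\bigcap_(k in [set` s]) Z k @^-1` B k) = (\prod_(k <- s) P (Z k @^-1` B k))%E.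

(** Given the variables in [s], the selected indices are fixed and at least [c] in number;
    independently, each is small with probability [1 - m^-alpha <= exp (- m^-alpha)]. *)
Lemma all_small_bound (s t : seq K) (J : T -> pred K) (c : R) (m : nat) (E : set T) :
  uniq (s ++ t) -> (0 < size t)%N -> (0 < m)%N -> measurable E ->
  (forall w w', readout Z s w = readout Z s w' -> J w = J w') ->
  (forall w, E w -> c <= (count (J w) t)%:R /\
     forall k, k \in t -> J w k -> (signed_abs (Z k w) < m)%N) ->
  (P E <= (expR (- (c * m%:R `^ (- alpha))))%:E)%E.
Proof.
move=> ust t0 m0 mE JE hE; apply: (indep_slice mZ indep ust mE (ltW (expR_gt0 _))) => w0.
(* If too few indices are selected, the fibre misses [E] and empty constraints do; their product is
   0 because [t] is nonempty. *)
have [ct|ct] := pselect (c <= (count (J w0) t)%:R); last first.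
  exists (fun=> set0) => [w k Ew sw|].
    by exfalso; apply: ct; rewrite -(JE _ _ sw); case: (hE w Ew).
  case: t t0 {ust hE ct} => // k t _; rewrite big_cons preimage_set0 measure0 mul0e.
  by rewrite lee_fin expR_ge0.
exists (fun k => if J w0 k then [set i | (signed_abs i < m)%N] else setT).
  move=> w k Ew sw kt; case: ifPn => // Jk /=; have [_] := hE w Ew; apply => //.
  by rewrite (JE _ _ sw).
set p := m%:R `^ (- alpha).
have small k : P (Z k @^-1` [set i | (signed_abs i < m)%N]) = (1 - p)%:E.
  have -> : Z k @^-1` [set i | (signed_abs i < m)%N] =
      ~` (Z k @^-1` [set i | (m <= signed_abs i)%N]).
    by apply/seteqP; split => w /=; rewrite ltnNge => /negP.
  by rewrite probability_setC// lawZ.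
have p1 : 0 <= 1 - p.
  by case: t t0 {ust hE ct} => // k t _; rewrite -lee_fin -(small k).
have -> : (\prod_(k <- t) P (Z k @^-1` (if J w0 k then [set i | (signed_abs i < m)%N]
    else [set: nat])) = ((1 - p) ^+ count (J w0) t)%:E)%E.
  elim: (t) => [|k t' ih]; first by rewrite big_nil.
  rewrite big_cons ih /=; case: ifP => _; last by rewrite preimage_setT probability_setT mul1e.
  by rewrite small -EFinM exprS.
rewrite lee_fin; apply: (@le_trans _ _ (expR (- p) ^+ count (J w0) t)).
  by rewrite lerXn2r ?nnegrE ?expR_ge0// expR_ge1Dx.
by rewrite -expRM_natl ler_expR mulrN lerN2 ler_wpM2r// powR_ge0.
Qed.

(** With the variables in [s] fixed, the absolute values attained at [k0] lie in [[N, N + L]], where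
    [N >= m] is the least of them. The mass of this range is a difference of tails, and the bound of
    [pareto_tail_diff] decreases in [N]. *)
Lemma small_diameter_bound (s : seq K) (k0 : K) (E : set T) (m L : nat) :
  uniq (rcons s k0) -> (0 < m)%N -> measurable E ->
  (forall w, E w -> (m <= signed_abs (Z k0 w))%N) ->
  (forall w w', E w -> E w' -> readout Z s w = readout Z s w' ->
     `|signed_val R (Z k0 w) - signed_val R (Z k0 w')| <= L%:R) ->
  (P E <= (2 * L.+1%:R * (m%:R `^ (- alpha) / m%:R))%:E)%E.
Proof.
move=> us m0 mE mEZ dE.
have mE0 : 0 <= 2 * L.+1%:R * ((m%:R : R) `^ (- alpha) / m%:R).
  by rewrite mulr_ge0// divr_ge0// powR_ge0.
rewrite -cats1 in us; apply: (indep_slice mZ indep us mE mE0) => w0.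
exists (fun k => [set c | exists w, [/\ E w, readout Z s w = readout Z s w0 & Z k0 w = c]]).
  by move=> w k Ew sw; rewrite inE => /eqP ->; exists w.
rewrite big_seq1; set C := [set c | _].
have [[c Cc]|C0] := pselect (C !=set0); last first.
  rewrite (_ : C = set0) ?preimage_set0 ?measure0 ?lee_fin//.
  by apply/seteqP; split => // c Cc; apply: C0; exists c.
have exN : exists N, `[< exists2 c, C c & signed_abs c = N >].
  by exists (signed_abs c); apply/asboolP; exists c.
case: (ex_minnP exN) => N /asboolP[c1 Cc1 c1N] Nmin.
have mN : (m <= N)%N.
  by case: Cc1 => w [Ew _ wc]; rewrite -c1N -wc; exact: mEZ.
have N0 : (0 < N)%N by exact: leq_trans m0 mN.
have CN : C `<=` [set i | (N <= signed_abs i)%N] `\` [set i | (N + L.+1 <= signed_abs i)%N].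
  move=> i Ci; split => /=; first by apply: Nmin; apply/asboolP; exists i.
  apply/negP; rewrite -ltnNge addnS ltnS.
  case: Ci Cc1 => w [Ew sw <-] [w' [Ew' sw' w'c1]].
  have := dE w w' Ew Ew' (etrans sw (esym sw')).
  have := lerB_dist (signed_val R (Z k0 w)) (signed_val R (Z k0 w')).
  rewrite !norm_signed_val w'c1 c1N => h1 h2.
  have := le_trans h1 h2; rewrite lerBlDl -natrD ler_nat; lia.
apply: (@le_trans _ _ (P (Z k0 @^-1` [set i | (N <= signed_abs i)%N] `\`
    Z k0 @^-1` [set i | (N + L.+1 <= signed_abs i)%N]))).
  apply: le_measure; rewrite ?inE//; first exact: measurableD.
  by move=> w Cw; exact: (CN _ Cw).
rewrite measureD//; last by rewrite ltey_eq fin_num_measure.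
rewrite setIidr; last by move=> w /=; lia.
have NL0 : (0 < N + L.+1)%N by rewrite addnS.
rewrite [X in (X - _)%E](lawZ k0 N0) [X in (_ - X)%E](lawZ k0 NL0).
rewrite -EFinB lee_fin natrD.
have N0R : (0 : R) < N%:R by rewrite ltr0n.
apply: (le_trans (pareto_tail_diff alpha2 N0R (ler0n R L.+1))).
rewrite ler_wpM2l// ler_pM ?powR_ge0 ?invr_ge0//.
  rewrite !powRN lef_pV2 ?posrE ?powR_gt0 ?ltr0n//.
  by apply: ge0_ler_powR; rewrite ?nnegrE ?ler_nat// ltW.
by rewrite lef_pV2 ?posrE ?ltr0n// ler_nat.
Qed.

End pareto_estimates.

(** * The row forms *)

Section deterministic.
Variables (R : realType) (u eta : R).
Hypotheses (u0 : 0 < u) (eta0 : 0 < eta).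
Variables (p n : nat).
Implicit Types (x : nat -> nat -> R) (i : 'I_p) (j : 'I_n).

Definition other_rows x i : 'M[R]_n :=
  (zero_row (self_normalized p n x) i)^T *m zero_row (self_normalized p n x) i.

Definition raw_row x i : 'cV[R]_n := \col_j x i j.

(** The raw row is used, so that with all other entries fixed this is a quadratic polynomial in each
    entry of row [i]; [lorentz_row_small] restores the normalization. *)
Definition row_form x i : R :=
  dot (raw_row x i) (lorentz u eta (other_rows x i) *m raw_row x i).

Lemma other_rows_sym x i : (other_rows x i)^T = other_rows x i.
Proof. exact: gramT_sym. Qed.

Lemma dot_raw_row x i : dot (raw_row x i) (raw_row x i) = \sum_(k < n) x i k ^+ 2.
Proof. by rewrite dotE; apply: eq_bigr => k _; rewrite !mxE -expr2. Qed.

Lemma row_self_normalized x i :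
  (row i (self_normalized p n x))^T =
  (Num.sqrt (dot (raw_row x i) (raw_row x i)))^-1 *: raw_row x i.
Proof. by apply/matrixP => j k; rewrite !mxE dot_raw_row mulrC. Qed.

Lemma dot_row_self_normalized x i :
  dot (row i (self_normalized p n x))^T (row i (self_normalized p n x))^T <= 1.
Proof.
rewrite row_self_normalized; set a := dot (raw_row x i) (raw_row x i).
have a0 : 0 <= a by exact: dotxx_ge0.
rewrite dotZl dotZr -/a mulrA -invfM -expr2 sqr_sqrtr//.
by have [->|an] := eqVneq a 0; rewrite ?mulr0// mulVf.
Qed.

(** The normalized form is [row_form x i] divided by the squared norm of the row, hence exceeds
    [eta]; one factor [eta] then cancels in [lorentz_row_bound]. *)
Lemma lorentz_row_small x i (t2 : R) : 0 < t2 ->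
  \sum_(k < n) x i k ^+ 2 < t2 -> eta * t2 < row_form x i ->
  lorentz u eta (sample_correlation p n x) i i <= 4 * (u + eta) * eta / u ^+ 2.
Proof.
move=> t20 xt Qt; rewrite -dot_raw_row in xt.
have := lorentz_row_bound u0 eta0 (self_normalized p n x) i.
rewrite -/(other_rows x i) -/(sample_correlation p n x) row_self_normalized.
set Q := row_form x i in Qt *; set F := lorentz _ _ _ i i; set a := dot (raw_row x i) (raw_row x i) in xt *.
have F0 : 0 <= F by apply: lorentz_diag_ge0 => //; exact: sample_correlation_sym.
have Q0 : 0 < Q by apply: lt_trans Qt; rewrite mulr_gt0.
have a0 : 0 < a.
  rewrite ltNge; apply/negP => /dotxx_eq0 x0.
  by move: Q0; rewrite /Q /row_form x0 mulmx0 /dot mulmx0 mxE ltxx.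
rewrite /= -scalemxAr dotZl dotZr -/(row_form x i) -/Q.
have -> : (Num.sqrt a)^-1 * ((Num.sqrt a)^-1 * Q) = a^-1 * Q.
  by rewrite mulrA -invfM -expr2 sqr_sqrtr// ltW.
move=> h.
have u2 : 0 < u ^+ 2 by rewrite exprn_gt0.
rewrite ler_pdivlMr// mulrC.
rewrite -(ler_pM2r (mulr_gt0 eta0 t20)).
apply: (@le_trans _ _ (u ^+ 2 * F * Q)).
  by rewrite ler_wpM2l ?mulr_ge0// ltW.
apply: (@le_trans _ _ (4 * (u + eta) * eta ^+ 2 * a)).
  rewrite -ler_pdivrMr//; apply: le_trans h.
  by rewrite le_eqVlt; apply/orP; left; apply/eqP; field; rewrite gt_eqF.
have -> : 4 * (u + eta) * eta * (eta * t2) = 4 * (u + eta) * eta ^+ 2 * t2 by ring.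
by rewrite ler_wpM2l ?ltW// !mulr_gt0// ?exprn_gt0// addr_gt0.
Qed.

Definition massive (kappa : R) x i : {set 'I_n} :=
  [set j | kappa <= lorentz u eta (other_rows x i) j j]%SET.

(** The trace passes to the [n] by [n] Gram matrix with loss [(p + n) eta / u], then to [other_rows]
    with loss [2 / eta]. Diagonal entries are at most 1, so the last trace is at most the number of
    massive indices plus [kappa n]. *)
Lemma massive_count x i (kappa : R) : 0 < kappa ->
  2 * kappa * n%:R + (p + n)%:R * eta / u + 2 / eta <=
    \tr (lorentz u eta (sample_correlation p n x)) ->
  kappa * n%:R <= #|massive kappa x i|%:R.
Proof.
move=> k0 h.
have h1 := lorentz_zero_row_trace u eta0 (dot_row_self_normalized x i).
have h2 := lorentz_gram_trace u eta0 (self_normalized p n x).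
rewrite -/(sample_correlation p n x) in h2.
rewrite -/(other_rows x i) in h1.
set TR := \tr _ in h h2; set TM := \tr _ in h1 h2; set TB := \tr _ in h1.
have h3 : TR - (p + n)%:R * eta / u <= TM.
  rewrite -(ler_pM2l u0); apply: le_trans h2.
  by rewrite mulrBr mulrCA divff ?gt_eqF// mulr1.
have h4 : TB <= #|massive kappa x i|%:R + kappa * n%:R.
  rewrite /TB /mxtrace.
  apply: (@le_trans _ _ (\sum_(j < n) ((j \in massive kappa x i)%:R + kappa))).
    apply: ler_sum => j _; rewrite inE.
    have := lorentz_diag_le1 u eta0 j (other_rows_sym x i).
    by case: (lerP kappa) => ? ?; rewrite ?mulr0n ?mulr1n; lra.
  rewrite big_split/= sumr_const card_ord -natr_sum mulr_natr lerD2r ler_nat.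
  by rewrite -sum1_card [X in (_ <= X)%N]big_mkcond/= leq_sum// => j _; case: ifP.
lra.
Qed.

Lemma other_rows_eq x x' i : (forall (l : 'I_p) (k : 'I_n), l != i -> x l k = x' l k) ->
  other_rows x i = other_rows x' i.
Proof.
move=> h; rewrite /other_rows.
suff -> : zero_row (self_normalized p n x) i = zero_row (self_normalized p n x') i by [].
apply/matrixP => l k; rewrite !mxE; case: ifPn => // li; rewrite h//.
by congr (_ / Num.sqrt _); apply: eq_bigr => k' _; rewrite h.
Qed.

Lemma sample_correlation_eq x x' : (forall (i : 'I_p) (j : 'I_n), x i j = x' i j) ->
  sample_correlation p n x = sample_correlation p n x'.
Proof.
move=> h; rewrite /sample_correlation.
suff -> : self_normalized p n x = self_normalized p n x' by [].
apply/matrixP => l k; rewrite !mxE h.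
by congr (_ / Num.sqrt _); apply: eq_bigr => k' _; rewrite h.
Qed.

(* By the parallelogram identity, the nonnegative form takes a value at most
   4 e at the difference of two rows where it is at most e. *)
Lemma row_form_diameter x x' i j (e kappa : R) :
  (forall (l : 'I_p) (k : 'I_n), l != i -> x l k = x' l k) ->
  (forall k : 'I_n, k != j -> x i k = x' i k) -> j \in massive kappa x i ->
  row_form x i <= e -> row_form x' i <= e ->
  kappa * (x i j - x' i j) ^+ 2 <= 4 * e.
Proof.
move=> hx hi; rewrite inE => kj; rewrite /row_form -(other_rows_eq hx).
set F := lorentz _ _ _ in kj *; set a := raw_row x i; set b := raw_row x' i => ae be.
have ab : a - b = (x i j - x' i j) *: delta_mx j 0.
  apply/matrixP => k l; rewrite !mxE ord1 eqxx andbT.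
  by case: eqVneq => [->|kj']; rewrite ?mulr1// mulr0 hi// subrr.
have F0 (c : 'cV_n) : 0 <= dot c (F *m c).
  by apply: lorentz_dot_ge0 => //; exact: other_rows_sym.
have Fs : dot b (F *m a) = dot a (F *m b).
  by rewrite dot_mulmxr dotC /F lorentz_tr//; exact: other_rows_sym.
have h1 : dot (a - b) (F *m (a - b)) = (x i j - x' i j) ^+ 2 * F j j.
  by rewrite ab -scalemxAr dotZl dotZr mulrA -expr2 -mx_entryE.
have h2 := F0 (a + b).
have h3 : (x i j - x' i j) ^+ 2 * F j j <= 4 * e.
  rewrite -h1; move: h2; rewrite mulmxDr mulmxBr !(dotDr, dotDl, dotNr, dotNl) Fs.
  lra.
by apply: le_trans h3; rewrite mulrC ler_wpM2l// sqr_ge0.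
Qed.

End deterministic.

(** * The bound in finite dimension *)

Section finite_bound.
Variables (R : realType) (alpha : R).
Hypotheses (alpha0 : 0 < alpha) (alpha2 : alpha < 2).
Context d (T : measurableType d) (P : probability T R).
Variable Z : nat * nat -> T -> nat.
Hypothesis mZ : forall k B, measurable (Z k @^-1` B).
Hypothesis lawZ : forall k (m : nat), (0 < m)%N ->
  P (Z k @^-1` [set i | (m <= signed_abs i)%N]) = (m%:R `^ (- alpha))%:E.
Hypothesis indep : forall (s : seq (nat * nat)) (B : nat * nat -> set nat), uniq s ->
  P (\bigcap_(k in [set` s]) Z k @^-1` B k) = (\prod_(k <- s) P (Z k @^-1` B k))%E.
Variables (u eta : R).
Hypotheses (u0 : 0 < u) (eta0 : 0 < eta).
Variables (p n : nat).

Definition entries (w : T) (i j : nat) : R := signed_val R (Z (i, j) w).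

Definition grid : seq (nat * nat) := [seq (i, j) | i <- iota 0 p, j <- iota 0 n].

Lemma mem_grid i j : ((i, j) \in grid) = (i < p)%N && (j < n)%N.
Proof.
apply/allpairsP/andP => [[[a b] /= [+ + [-> ->]]]|[ip jn]].
  by rewrite !mem_iota.
by exists (i, j); rewrite /= !mem_iota.
Qed.

Lemma uniq_grid : uniq grid.
Proof. by apply: allpairs_uniq; rewrite ?iota_uniq// => -[a b] [c e] _ _ [-> ->]. Qed.

Lemma readout_eq (s : seq (nat * nat)) w w' k :
  readout Z s w = readout Z s w' -> k \in s -> Z k w = Z k w'.
Proof. by move=> /eq_in_map h ks; exact: h. Qed.

Lemma entries_eq w w' : readout Z grid w = readout Z grid w' ->
  forall (i : 'I_p) (j : 'I_n), entries w i j = entries w' i j.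
Proof.
by move=> e i j; rewrite /entries (readout_eq e)// mem_grid !ltn_ord.
Qed.

Let big_correlation (h : R) : set T :=
  [set w | h * p%:R <= \tr (lorentz u eta (sample_correlation p n (entries w)))].

Lemma measurable_big_correlation h : measurable (big_correlation h).
Proof.
apply: (measurable_of_readout mZ (s := grid)) => w w' e; rewrite /big_correlation/=.
by rewrite (sample_correlation_eq (entries_eq e)).
Qed.

Variables (kappa : R) (m t L : nat).
Hypotheses (kappa0 : 0 < kappa) (m0 : (0 < m)%N) (t0 : (0 < t)%N) (n0 : (0 < n)%N).
Hypothesis kappaL : 4 * (eta * t%:R ^+ 2) <= kappa * L%:R ^+ 2.

(** This and the next two events are the ways in which row [i] can fail: too large a norm, no large
    entry at a massive index, a large entry there but a small form. When the trace is large, a row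
    avoiding all of them has a small diagonal entry. *)
Let big_row (i : 'I_p) : set T :=
  [set w | t%:R ^+ 2 <= \sum_(j < n) (signed_abs (Z (val i, val j) w))%:R ^+ 2 :> R].

Let small_entries (i : 'I_p) : set T :=
  [set w | kappa * n%:R <= #|massive u eta n kappa (entries w) i|%:R /\
    forall j : 'I_n, j \in massive u eta n kappa (entries w) i ->
      (signed_abs (Z (val i, val j) w) < m)%N].

Let small_form (i : 'I_p) (j : 'I_n) : set T :=
  [set w | [/\ j \in massive u eta n kappa (entries w) i,
    (m <= signed_abs (Z (val i, val j) w))%N &
    row_form u eta n (entries w) i <= eta * t%:R ^+ 2]].

Let measurable_grid (E : set T) :
  (forall w w', (forall (i : 'I_p) (j : 'I_n), Z (val i, val j) w = Z (val i, val j) w') ->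
    E w -> E w') -> measurable E.
Proof.
move=> h; apply: (measurable_of_readout mZ (s := grid)) => w w' e; apply: h => i j.
by apply: (readout_eq e); rewrite mem_grid !ltn_ord.
Qed.

Let other_rows_grid w w' (i : 'I_p) :
  (forall (l : 'I_p) (j : 'I_n), l != i -> Z (val l, val j) w = Z (val l, val j) w') ->
  other_rows n (entries w) i = other_rows n (entries w') i.
Proof. by move=> h; apply: other_rows_eq => l k li; rewrite /entries h. Qed.

Lemma measurable_big_row i : measurable (big_row i).
Proof.
apply: measurable_grid => w w' e; rewrite /big_row /=.
by under eq_bigr do rewrite e.
Qed.

Lemma measurable_small_entries i : measurable (small_entries i).
Proof.
apply: measurable_grid => w w' e; rewrite /small_entries /= /massive.
rewrite (other_rows_grid (w' := w')) => [[h1 h2]|l j _]; last exact: e.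
by split => // j jm; rewrite -e; exact: h2.
Qed.

Lemma measurable_small_form i j : measurable (small_form i j).
Proof.
apply: measurable_grid => w w' e; rewrite /small_form /= /massive /row_form.
rewrite (other_rows_grid (w' := w')) => [|l k _]; last exact: e.
rewrite e; suff -> : raw_row n (entries w) i = raw_row n (entries w') i by [].
by apply/matrixP => k l; rewrite !mxE /entries e.
Qed.

Lemma big_row_bound i :
  (P (big_row i) <= (n%:R * (6 / (2 - alpha) * t%:R `^ (- alpha)))%:E)%E.
Proof. exact: (sum_square_tail alpha0 alpha2 mZ lawZ (fun j : 'I_n => (val i, val j)) t0). Qed.

(** Conditioning is on the entries outside row [i]: they determine the massive indices and are
    independent of row [i]. *)
Lemma small_entries_bound i :
  (P (small_entries i) <= (expR (- (kappa * n%:R * m%:R `^ (- alpha))))%:E)%E.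
Proof.
pose s := [seq a : nat * nat <- grid | a.1 != val i].
pose r := [seq (val i, j) | j <- iota 0 n].
pose J w (k : nat * nat) := if insub k.2 is Some j then
  j \in massive u eta n kappa (entries w) i else false.
have Jj w (j : 'I_n) : J w (val i, val j) = (j \in massive u eta n kappa (entries w) i).
  by rewrite /J /= valK.
refine (@all_small_bound _ alpha _ _ P _ Z mZ lawZ indep s r J (kappa * n%:R) m
  (small_entries i) _ _ m0 _ _ _).
- rewrite cat_uniq filter_uniq ?uniq_grid//=; apply/andP; split.
    by apply/hasPn => k /mapP[j _ ->]; rewrite mem_filter /= eqxx.
  by rewrite map_inj_uniq ?iota_uniq// => a b [].
- by rewrite size_map size_iota.
- exact: measurable_small_entries.
- move=> w w' e.
  have B : other_rows n (entries w) i = other_rows n (entries w') i.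
    apply: other_rows_grid => l k li; apply: (readout_eq e).
    by rewrite mem_filter /= val_eqE li mem_grid !ltn_ord.
  by rewrite /J /massive B.
- move=> w [h1 h2]; split; last first.
    move=> k /mapP[j]; rewrite mem_iota add0n => jn -> Jk.
    by have := h2 (Ordinal jn); rewrite /= -Jj; exact.
  suff -> : count (J w) r = #|massive u eta n kappa (entries w) i| by [].
  rewrite /r count_map -val_enum_ord count_map.
  rewrite cardE [in RHS]/enum_mem size_filter -enumT; apply: eq_count => j.
  by rewrite /= Jj.
Qed.

(** Conditioning is on all entries but [(i, j)]; then [row_form_diameter] and [kappaL] confine that
    entry to a range of length [L]. *)
Lemma small_form_bound i j :
  (P (small_form i j) <= (2 * L.+1%:R * (m%:R `^ (- alpha) / m%:R))%:E)%E.
Proof.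
pose s := [seq a : nat * nat <- grid | a != (val i, val j)].
refine (@small_diameter_bound _ alpha alpha0 alpha2 _ _ P _ Z mZ lawZ indep s
  (val i, val j) (small_form i j) m L _ m0 _ _ _).
- by rewrite rcons_uniq filter_uniq ?uniq_grid// mem_filter eqxx.
- exact: measurable_small_form.
- by move=> w [].
move=> w w' [h1 h2 h3] [h1' h2' h3'] e.
have eZ (l : 'I_p) (k : 'I_n) : (val l, val k) != (val i, val j) ->
    Z (val l, val k) w = Z (val l, val k) w'.
  by move=> lk; apply: (readout_eq e); rewrite mem_filter lk mem_grid !ltn_ord.
have := @row_form_diameter _ u eta eta0 p n (entries w) (entries w') i j
  (eta * t%:R ^+ 2) kappa.
move=> /(_ _ _ h1 h3 h3') h.
have {}h : kappa * (entries w i j - entries w' i j) ^+ 2 <= kappa * L%:R ^+ 2.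
  apply: le_trans kappaL; apply: h => [l k li|k kj]; rewrite /entries eZ//.
    by apply: contraNneq li => -[/val_inj ->].
  by apply: contraNneq kj => -[/val_inj ->].
rewrite ler_pM2l// in h.
by rewrite -[leRHS](@ger0_norm R)// -ler_sqr ?nnegrE// !real_normK ?num_real.
Qed.

Hypothesis p0 : (0 < p)%N.
Variable h : R.
Hypothesis h0 : 0 < h.
Hypothesis kappa_small : 2 * kappa * n%:R + (p + n)%:R * eta / u + 2 / eta <= h / 2 * p%:R.
Hypothesis eta_small : 4 * (u + eta) * eta / u ^+ 2 <= h / 4.

(** A diagonal entry is at most [h / 4] plus the number of failures of its row, since it never
    exceeds 1. A trace of at least [(h / 2) p] thus forces at least [(h / 4) p] failures; Markov's
    inequality applies, and the factor [p] cancels. *)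
Lemma big_correlation_bound :
  ((h / 4)%:E * P (big_correlation (h / 2)) <=
   (n%:R * (6 / (2 - alpha) * t%:R `^ (- alpha)) +
    expR (- (kappa * n%:R * m%:R `^ (- alpha))) +
    n%:R * (2 * L.+1%:R * (m%:R `^ (- alpha) / m%:R)))%:E)%E.
Proof.
pose E (ic : 'I_p * (bool + 'I_n)) := match ic.2 with
  | inl true => big_row ic.1 | inl false => small_entries ic.1
  | inr j => small_form ic.1 j end.
have mE ic : measurable (E ic).
  case: ic => i [[]|j]; rewrite /E/=; [exact: measurable_big_row|
    exact: measurable_small_entries|exact: measurable_small_form].
have W0 : 0 <= h / 4 * p%:R by rewrite mulr_ge0// divr_ge0// ltW.
have := @markov_indicators _ _ R P _ (fun=> 1) E _ _ (fun=> ler01) mE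
  (measurable_big_correlation (h / 2)) W0.
have hE w : big_correlation (h / 2) w ->
    h / 4 * p%:R <= \sum_ic 1 * \1_(E ic) w.
  move=> Ww; rewrite -(pair_bigA _ (fun i c => 1 * \1_(E (i, c)) w))/=.
  pose F i := lorentz u eta (sample_correlation p n (entries w)) i i.
  have Fi i : F i <= h / 4 + \sum_c 1 * \1_(E (i, c)) w.
    have [[c Ec]|nE] := pselect (exists c, E (i, c) w).
      rewrite (bigD1 c)//= indicE mem_set// mulr1.
      have F1 : F i <= 1.
        by apply: lorentz_diag_le1 => //; exact: sample_correlation_sym.
      have S0 : 0 <= \sum_(c' | c' != c) 1 * \1_(E (i, c')) w :> R.
        by rewrite sumr_ge0// => c' _; rewrite mulr_ge0.
      by apply: (le_trans F1); rewrite addrCA lerDl addr_ge0// divr_ge0// ltW.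
    apply: (@le_trans _ _ (h / 4)); last first.
      by rewrite lerDl sumr_ge0// => c _; rewrite mulr_ge0.
    apply: le_trans eta_small; apply: (@lorentz_row_small _ _ _ u0 eta0 _ _ _ _ (t%:R ^+ 2)).
    - by rewrite exprn_gt0// ltr0n.
    - rewrite ltNge; apply/negP => tw; apply: nE; exists (inl true).
      rewrite /E /big_row /=; apply: (le_trans tw); apply: ler_sum => k _.
      by rewrite -norm_signed_val real_normK ?num_real.
    - rewrite ltNge; apply/negP => Qt.
      have [[j [jm mj]]|nj] := pselect (exists j, j \in massive u eta n kappa (entries w) i /\
          (m <= signed_abs (Z (val i, val j) w))%N).
        by apply: nE; exists (inr j); split.
      (* The number of massive indices required by [small_entries] comes from the large trace [Ww],
         through [massive_count]. *)
      apply: nE; exists (inl false); split => /=.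
        apply: massive_count => //; apply: le_trans kappa_small _; exact: Ww.
      move=> j jm; rewrite ltnNge; apply/negP => mj; apply: nj; by exists j.
  have : \sum_i F i <= \sum_i (h / 4 + \sum_c 1 * \1_(E (i, c)) w).
    by apply: ler_sum.
  rewrite big_split/= sumr_const card_ord => FS.
  have {FS} := le_trans Ww FS; rewrite -[h / 4 *+ p]mulr_natr -lerBlDl; apply: le_trans.
  by rewrite -mulrBl; apply: ler_wpM2r => //; move: h0; lra.
move=> /(_ hE) {hE}.
rewrite -(pair_bigA _ (fun i c => (1%:E * P (E (i, c)))%E))/=.
set b := (X in (_ <= X%:E)%E).
have rowE i : (\sum_c 1%:E * P (E (i, c)) <= b%:E)%E.
  under eq_bigr do rewrite mul1e.
  rewrite big_sumType/= big_bool /b !EFinD; apply: leeD; first apply: leeD.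
  - exact: big_row_bound.
  - exact: small_entries_bound.
  - apply: (@le_trans _ _ (\sum_(j < n)
        (2 * L.+1%:R * (m%:R `^ (- alpha) / m%:R))%:E)%E).
      by apply: lee_sum => j _; exact: small_form_bound.
    by rewrite sumEFin sumr_const card_ord -[X in (X%:E <= _)%E]mulr_natl lexx.
move=> le1; have {le1} := le_trans le1 (lee_sum _ (fun i _ => rowE i)).
rewrite sumEFin sumr_const card_ord -[b *+ p]mulr_natr.
have : P (big_correlation (h / 2)) \is a fin_num.
  by rewrite fin_num_measure//; exact: measurable_big_correlation.
case: (P _) => // r _; rewrite -!EFinM !lee_fin mulrAC ler_pM2r// ltr0n//.
Qed.

End finite_bound.

(** * Choice of the scales *)

Section parameters.
Variables (R : realType) (alpha gamma u h : R).
Hypotheses (alpha0 : 0 < alpha) (alpha2 : alpha < 2) (gamma0 : 0 < gamma).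
Hypotheses (u0 : 0 < u) (h0 : 0 < h).

Lemma natr_above (x : R) : exists2 n : nat, (0 < n)%N & x <= n%:R.
Proof. by exists (Num.truncn x).+1 => //; exact: ltW (truncnS_gt _). Qed.

Lemma natr_powR_above (x : R) : exists2 m : nat, (0 < m)%N & x <= m%:R `^ alpha.
Proof.
have y0 : 0 < Num.max x 1 by rewrite lt_max ltr01 orbT.
have [l hl] := pareto_tail_cvg0 alpha0 (eqbRL (invr_gt0 _) y0).
exists l.+1 => //; have := hl l (leqnn l).
rewrite /pareto_tail powRN ltf_pV2 ?posrE ?powR_gt0// => /ltW.
by apply: le_trans; rewrite le_max lexx.
Qed.

(* The scales are m for a large entry, t = T m for the norm of a row, and L of
   order m / D for the length of the bad interval; n is of order s m^alpha and
   eta = kappa / (2 T D)^2.  They are chosen in the order kappa, s, T, D, m. *)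
Lemma bound_parameters : exists2 eta : R, 0 < eta & forall N : nat,
  exists n m t L : nat, exists kappa : R, let p := Num.truncn (gamma * n%:R) in
  [/\ [/\ (N <= n)%N, (0 < n)%N, (0 < m)%N, (0 < t)%N & (0 < p)%N],
      0 < kappa, 4 * (eta * t%:R ^+ 2) <= kappa * L%:R ^+ 2,
      2 * kappa * n%:R + (p + n)%:R * eta / u + 2 / eta <= h / 2 * p%:R /\
      4 * (u + eta) * eta / u ^+ 2 <= h / 4 &
      n%:R * (6 / (2 - alpha) * t%:R `^ (- alpha)) +
      expR (- (kappa * n%:R * m%:R `^ (- alpha))) +
      n%:R * (2 * L.+1%:R * (m%:R `^ (- alpha) / m%:R)) < h / 8].
Proof.
(* With this value [2 kappa n] is a quarter of [(h / 2) gamma n]; a second quarter absorbs the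
   [eta / u] term, a third [2 / eta] and the rounding of [p]. *)
pose kappa := h * gamma / 16.
have k0 : 0 < kappa by rewrite /kappa !mulr_gt0.
have [s s0 hs] : exists2 s : R, 0 < s & expR (- (kappa * s)) <= h / 32.
  have [n n0 hn] := natr_above (32 / (h * kappa)).
  exists n%:R; first by rewrite ltr0n.
  have e0 : 0 < kappa * n%:R by rewrite mulr_gt0// ltr0n.
  rewrite expRN invf_ple ?posrE ?expR_gt0 ?divr_gt0//.
  apply: (@le_trans _ _ (kappa * n%:R)); last first.
    by apply: le_trans (expR_ge1Dx _); rewrite lerDr.
  apply: (@le_trans _ _ (kappa * (32 / (h * kappa)))); last by rewrite ler_wpM2l// ltW.
  by rewrite le_eqVlt; apply/orP; left; apply/eqP; field; rewrite !gt_eqF.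
pose C := 6 / (2 - alpha).
have C0 : 0 < C by rewrite divr_gt0// subr_gt0.
have [Tn T0 hT] : exists2 T : nat, (0 < T)%N & (s + 1) * C * T%:R `^ (- alpha) <= h / 32.
  have [T T0 hT] := natr_powR_above ((s + 1) * C / (h / 32)).
  exists T => //; rewrite powRN ler_pdivrMr ?powR_gt0 ?ltr0n//.
  by rewrite [leRHS]mulrC -ler_pdivrMr// divr_gt0.
have [e0 e00 he0] : exists2 e0 : R, 0 < e0 & forall eta, 0 < eta -> eta <= e0 ->
    4 * (u + eta) * eta / u ^+ 2 <= h / 4 /\ (1 + gamma) * eta / u <= h * gamma / 8.
  exists (Num.min u (Num.min (h * u / 32) (h * gamma * u / (8 * (1 + gamma))))).
    by rewrite !lt_min u0 !divr_gt0 ?mulr_gt0 ?addr_gt0.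
  move=> eta eta0; rewrite !le_min => /and3P[e1 e2 e3]; split.
    rewrite ler_pdivrMr ?exprn_gt0//.
    have : (u + eta) * eta <= (u + u) * (h * u / 32).
      by apply: ler_pM => //; [exact/ltW/addr_gt0|exact: ltW|rewrite lerD2l].
    rewrite expr2; lra.
  rewrite ler_pdivrMr//; have g1 : 0 < 8 * (1 + gamma) by rewrite mulr_gt0// addr_gt0.
  rewrite ler_pdivlMr// in e3; lra.
have [D D0 [hD1 hD2]] : exists2 D : nat, (0 < D)%N &
    kappa / (4 * e0) <= D%:R /\ 2 * (s + 1) / (h / 32) <= D%:R.
  have [D1 D10 h1] := natr_above (kappa / (4 * e0)).
  have [D2 D20 h2] := natr_above (2 * (s + 1) / (h / 32)).
  exists (D1 + D2)%N; first by rewrite addn_gt0 D10.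
  by split; [apply: (le_trans h1)|apply: (le_trans h2)]; rewrite ler_nat ?leq_addr ?leq_addl.
have Dr0 : (0 : R) < D%:R by rewrite ltr0n.
have Tr0 : (0 : R) < Tn%:R by rewrite ltr0n.
(* This makes [4 eta (T m)^2 = kappa (m / D)^2] for every [m]. So [eta] is fixed before [N], as the
   test function in the weak convergence requires. *)
pose eta := kappa / (4 * (Tn%:R * D%:R) ^+ 2).
have eta0 : 0 < eta by rewrite /eta divr_gt0// mulr_gt0// exprn_gt0// mulr_gt0.
have ele : eta <= e0.
  have D1 : 1 <= D%:R :> R by rewrite ler1n.
  have T1 : 1 <= Tn%:R :> R by rewrite ler1n.
  rewrite /eta ler_pdivrMr ?mulr_gt0 ?exprn_gt0 ?mulr_gt0//.
  rewrite ler_pdivrMr ?mulr_gt0// in hD1; apply: (le_trans hD1).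
  have TD : D%:R <= (Tn%:R * D%:R) ^+ 2 :> R.
    rewrite exprMn; apply: (@le_trans _ _ (1 * D%:R ^+ 2)); last first.
      by rewrite ler_wpM2r ?sqr_ge0// exprn_ege1.
    by rewrite mul1r expr2 ler_peMr// ltW.
  have : D%:R * e0 <= (Tn%:R * D%:R) ^+ 2 * e0 by rewrite ler_wpM2r// ltW.
  lra.
have [he1 he2] := he0 _ eta0 ele.
exists eta => // N.
(* [M1] bounds [m] below, to absorb the rounding of [L]; [M2] and [M3] bound [n] below, for
   [2 / eta] and for [p > 0]. *)
have [M1 M10 hM1] := natr_above (64 * (4 * (s + 1)) / h).
have [M2 M20 hM2] := natr_above ((h / 2 + 2 / eta) / (h * gamma / 8)).
have [M3 M30 hM3] := natr_above (1 / gamma).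
have [m m0 hm] : exists2 m : nat, (M1 <= m)%N &
    (N + M2 + M3)%:R / s <= m%:R `^ alpha.
  have [m m0 hm] := natr_powR_above ((N + M2 + M3)%:R / s).
  exists (M1 + m)%N; first by rewrite leq_addr.
  apply: (le_trans hm); apply: ge0_ler_powR; rewrite ?nnegrE ?ler_nat ?leq_addl// ltW//.
have m1 : (0 < m)%N by apply: leq_trans M10 m0.
have mr0 : (0 : R) < m%:R by rewrite ltr0n.
have ma1 : 1 <= m%:R `^ alpha.
  by rewrite -[leLHS](powRr0 m%:R); apply: ler_powR; rewrite ?ler1n// ltW.
(* Rounding up keeps [n m^-alpha] between [s] and [s + 1], because [m^alpha >= 1]. *)
pose n := (Num.truncn (s * m%:R `^ alpha)).+1.
have sm0 : 0 <= s * m%:R `^ alpha by rewrite mulr_ge0 ?powR_ge0// ltW.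
have nlo : s * m%:R `^ alpha <= n%:R by exact: ltW (truncnS_gt _).
have nhi : n%:R <= (s + 1) * m%:R `^ alpha.
  rewrite /n -natr1 mulrDl mul1r lerD// truncn_le//.
have nN : (N + M2 + M3 <= n)%N.
  rewrite -(ler_nat R); apply: le_trans nlo.
  by rewrite mulrC -ler_pdivrMr.
have nr0 : (0 : R) < n%:R by rewrite ltr0n.
exists n, m, (Tn * m)%N, (m %/ D).+1, kappa => p.
have gn0 : 0 <= gamma * n%:R by rewrite mulr_ge0// ltW.
have plo : gamma * n%:R - 1 <= p%:R by rewrite lerBlDr natr1 ltW// truncnS_gt.
have phi : p%:R <= gamma * n%:R by rewrite truncn_le.
have p0 : (0 < p)%N.
  rewrite truncn_gt0; apply: (@le_trans _ _ (gamma * M3%:R)).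
    by rewrite mulrC -ler_pdivrMr.
  by rewrite ler_wpM2l ?(ltW gamma0)// ler_nat (leq_trans _ nN)// leq_addl.
split => //.
- split; rewrite ?muln_gt0 ?T0//.
  by apply: leq_trans nN; rewrite -addnA leq_addr.
- have mL : m%:R <= (m %/ D).+1%:R * D%:R :> R.
    by rewrite -natrM ler_nat ltnW// ltn_ceil.
  have -> : 4 * (eta * (Tn * m)%:R ^+ 2) = kappa * (m%:R / D%:R) ^+ 2.
    by rewrite natrM /eta; field; rewrite !gt_eqF.
  rewrite ler_wpM2l ?(ltW k0)// lerXn2r ?nnegrE ?divr_ge0//.
  by rewrite ler_pdivrMr.
- split => //.
  have hg0 : 0 < h * gamma / 8 by rewrite divr_gt0// mulr_gt0.
  have i1 : h / 2 + 2 / eta <= h * gamma / 8 * n%:R.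
    rewrite [leRHS]mulrC -ler_pdivrMr//; apply: (le_trans hM2); rewrite ler_nat.
    by apply: leq_trans nN; rewrite addnAC leq_addl.
  have i2 : (p + n)%:R * eta / u <= h * gamma / 8 * n%:R.
    apply: (@le_trans _ _ ((1 + gamma) * eta / u * n%:R)); last by rewrite ler_wpM2r.
    have -> : (1 + gamma) * eta / u * n%:R = (gamma * n%:R + n%:R) * (eta / u) by ring.
    rewrite -mulrA; apply: ler_wpM2r; first by rewrite divr_ge0 ?(ltW eta0) ?(ltW u0).
    by rewrite natrD lerD2r.
  have i3 : h / 2 * (gamma * n%:R - 1) <= h / 2 * p%:R.
    by rewrite ler_wpM2l// divr_ge0// ltW.
  have -> : 2 * kappa * n%:R = h * gamma / 8 * n%:R by rewrite /kappa; field.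
  rewrite (_ : h / 2 * (gamma * n%:R - 1) = 4 * (h * gamma / 8 * n%:R) - h / 2) in i3; last by field.
  have : 0 <= h * gamma / 8 * n%:R by rewrite mulr_ge0// ltW.
  move: i1 i2 i3; set a := h * gamma / 8 * n%:R; set b := 2 / eta.
  set c := _ * eta / u; set d := h / 2 * p%:R; lra.
rewrite -/C; set q := n%:R * m%:R `^ (- alpha).
have ma0 : 0 < m%:R `^ alpha :> R by rewrite powR_gt0.
have qlo : s <= q by rewrite /q powRN ler_pdivlMr.
have qhi : q <= s + 1 by rewrite /q powRN ler_pdivrMr.
have q0 : 0 <= q by apply: le_trans qlo; exact: ltW.
(* The three error terms get [h / 32], [h / 32] and [h / 32 + h / 64]; their sum is
   [7 h / 64 < h / 8]. *)
have b1 : n%:R * (C * (Tn * m)%:R `^ (- alpha)) <= h / 32.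
  apply: le_trans hT; rewrite natrM powRM//.
  have -> : n%:R * (C * (Tn%:R `^ (- alpha) * m%:R `^ (- alpha))) =
    q * (C * Tn%:R `^ (- alpha)) by rewrite /q; ring.
  by rewrite -mulrA ler_wpM2r// mulr_ge0 ?powR_ge0// ltW.
have b2 : expR (- (kappa * n%:R * m%:R `^ (- alpha))) <= h / 32.
  by apply: le_trans hs; rewrite -mulrA -/q ler_expR lerN2 ler_wpM2l// ltW.
have b3 : n%:R * (2 * (m %/ D).+2%:R * (m%:R `^ (- alpha) / m%:R)) <= h / 32 + h / 64.
  have -> : n%:R * (2 * (m %/ D).+2%:R * (m%:R `^ (- alpha) / m%:R)) =
    q * (2 * (m %/ D).+2%:R / m%:R) by rewrite /q; ring.
  have Lm : (m %/ D).+2%:R <= m%:R / D%:R + 2 :> R.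
    rewrite -addn2 natrD lerD2r ler_pdivlMr// -natrM ler_nat; exact: leq_divM.
  have c1 : 2 * (s + 1) / D%:R <= h / 32.
    by rewrite ler_pdivrMr// [leRHS]mulrC -ler_pdivrMr// divr_gt0.
  have c2 : 4 * (s + 1) / m%:R <= h / 64.
    rewrite ler_pdivrMr//; rewrite ler_pdivrMr// in hM1.
    have : M1%:R * h <= m%:R * h by rewrite ler_wpM2r ?(ltW h0)// ler_nat.
    lra.
  apply: (@le_trans _ _ ((s + 1) * (2 * (m%:R / D%:R + 2) / m%:R))).
    by apply: ler_pM => //; rewrite ler_wpM2r ?invr_ge0// ler_wpM2l.
  have -> : (s + 1) * (2 * (m%:R / D%:R + 2) / m%:R) =
      2 * (s + 1) / D%:R + 4 * (s + 1) / m%:R by field; rewrite !gt_eqF.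
  exact: lerD.
have := lerD (lerD b1 b2) b3; move: h0; set X := (_ + _ + _); lra.
Qed.

End parameters.

(** * Dimensions of ratio [gamma], almost sure events and the test function *)

Lemma truncn_mul_cvg_infty (R : realType) (gamma : R) : 0 < gamma ->
  Num.truncn (gamma * n%:R) @[n --> \oo] --> \oo.
Proof.
move=> g0 A [N _ NA]; exists (Num.truncn (N%:R / gamma)).+1 => // n /= hn.
apply: NA => /=; rewrite truncn_ge_nat ?mulr_ge0// ?(ltW g0)// mulrC.
rewrite -ler_pdivrMr//; apply: ltW; apply: lt_le_trans (truncnS_gt _) _.
by rewrite ler_nat.
Qed.

Lemma truncn_mul_ratio_cvg (R : realType) (gamma : R) : 0 < gamma ->
  (Num.truncn (gamma * n%:R))%:R / n%:R @[n --> \oo] --> gamma.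
Proof.
move=> g0; apply/cvgrPdist_le => e e0.
exists (Num.truncn e^-1).+1 => // n /= hn.
have n0 : (0 : R) < n%:R by rewrite ltr0n; apply: leq_trans hn.
have en : e^-1 <= n%:R.
  by apply: ltW; apply: lt_le_trans (truncnS_gt _) _; rewrite ler_nat.
have gn0 : 0 <= gamma * n%:R by rewrite mulr_ge0// ltW.
set k := (Num.truncn _)%:R.
have k1 : k <= gamma * n%:R by rewrite truncn_le.
have k2 : gamma * n%:R < k + 1 by rewrite natr1 truncnS_gt.
have -> : gamma - k / n%:R = (gamma * n%:R - k) / n%:R by field; rewrite gt_eqF.
rewrite ger0_norm ?divr_ge0 ?subr_ge0// ler_pdivrMr//.
have : 1 <= e * n%:R by rewrite mulrC -ler_pdivrMr// div1r.
lra.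
Qed.

(** The events [V N] that [W n] holds for all [n >= N] increase to an almost sure event, so their
    probabilities tend to 1. *)
Lemma ae_eventually_half d (T : measurableType d) (R : realType)
    (P : probability T R) (W : nat -> set T) :
  (forall n, measurable (W n)) -> {ae P, forall w, \forall n \near \oo, W n w} ->
  exists N, forall n, (N <= n)%N -> ((2^-1)%:E <= P (W n))%E.
Proof.
move=> mW [A [mA A0 WA]].
pose V N := \bigcap_(n in [set n | (N <= n)%N]) W n.
have mV N : measurable (V N) by exact: bigcap_measurableType.
have mU : measurable (\bigcup_N V N) by exact: bigcup_measurable.
have ndV : nondecreasing_seq V.
  move=> N M NM; apply/subsetPset => w VN n /= Mn; apply: VN.
  exact: leq_trans Mn.
have PU : P (\bigcup_N V N) = 1%E.
  apply/eqP; rewrite eq_le probability_le1//=.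
  have : (P (~` \bigcup_N V N) <= P A)%E.
    apply: le_measure; [by rewrite inE; exact: measurableC|by rewrite inE|].
    move=> w nU; apply: WA; move=> [N _ WN]; apply: nU; exists N; first by [].
    by move=> n Nn; exact: WN.
  rewrite A0 probability_setC// => h; rewrite -[leRHS]add0e -leeBlDr//.
  by rewrite fin_num_measure.
have cv : P \o V @ \oo --> 1%E by rewrite -PU; exact: nondecreasing_cvg_mu.
have [[N hN]|no] := pselect (exists N, ((2^-1)%:E <= P (V N))%E).
  exists N => n Nn; apply: (le_trans hN); apply: le_measure; rewrite ?inE//.
  by move=> w; exact.
exfalso; have : (1 <= (2^-1)%:E :> \bar R)%E.
  rewrite -(cvg_lim _ cv)//; apply: lime_le; first by apply/cvg_ex; exists 1%E.
  apply: nearW => N; rewrite leNgt; apply/negP => /ltW h; apply: no; by exists N.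
rewrite lee_fin; lra.
Qed.

Section lorentzian.
Variables (R : realType) (u eta : R).
Hypothesis eta0 : 0 < eta.

Lemma lorentzian_continuous : continuous (lorentzian u eta).
Proof.
move=> x; apply: cvgM; first exact: cvg_cst.
apply: cvgV; first by rewrite gt_eqF// ltr_wpDl ?sqr_ge0// exprn_gt0.
apply: cvgD; last exact: cvg_cst.
by apply: cvgM; (apply: cvgB; [exact: cvg_id|exact: cvg_cst]).
Qed.

Lemma lorentzian_ge0 x : 0 <= lorentzian u eta x.
Proof. by rewrite divr_ge0 ?addr_ge0 ?sqr_ge0. Qed.

Lemma lorentzian_le1 x : lorentzian u eta x <= 1.
Proof.
have d0 : 0 < (x - u) ^+ 2 + eta ^+ 2 by rewrite ltr_wpDl ?sqr_ge0// exprn_gt0.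
by rewrite ler_pdivrMr// mul1r lerDr sqr_ge0.
Qed.

Lemma lorentzian_center : lorentzian u eta u = 1.
Proof. by rewrite /lorentzian subrr expr0n add0r divff// gt_eqF// exprn_gt0. Qed.

Lemma atom_le_integral_lorentzian (H : probability (measurableTypeR R) R) :
  (H [set u] <= \int[H]_x (lorentzian u eta x)%:E)%E.
Proof.
have m1 : measurable ([set u] : set (measurableTypeR R)) by exact: measurable_set1.
have mb : measurable_fun setT (EFin \o (lorentzian u eta : measurableTypeR R -> R)).
  apply/measurable_EFinP; apply: continuous_measurable_fun; exact: lorentzian_continuous.
have -> : H [set u] = (\int[H]_x (\1_[set u] x)%:E)%E by rewrite integral_indic// setIT.
apply: ge0_le_integral => //=; first by apply/measurable_EFinP; exact: measurable_indic.
move=> x ?; rewrite lee_fin indicE; have [xu|xu] := pselect (x = u).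
  by rewrite xu lorentzian_center mem_set.
by rewrite memNset// lorentzian_ge0.
Qed.

End lorentzian.

(** * A positive atom against the bound in finite dimension *)

Theorem proposition4p5 (R : realType) (alpha gamma : R)
    (alpha_gt0 : 0 < alpha) (alpha_lt2 : alpha < 2) (gamma_gt0 : 0 < gamma)
    (H : probability (measurableTypeR R) R)
    (H_heavyMP : heavy_Marchenko_Pastur alpha gamma H)
    (u : R) (u_gt0 : 0 < u) :
  H [set u] = 0%E.
Proof.
have m1 : measurable ([set u] : set (measurableTypeR R)) by exact: measurable_set1.
apply/eqP; rewrite -measure_le0 leNgt; apply/negP => Hu.
pose h := fine (H [set u]).
have hE : H [set u] = h%:E by rewrite fineK// fin_num_measure.
have h0 : 0 < h by rewrite -lte_fin -hE.
have [eta eta0 params] := bound_parameters alpha_gt0 alpha_lt2 gamma_gt0 u_gt0 h0.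
pose pn n := Num.truncn (gamma * n%:R).
pose Z := pareto_index alpha.
have mZ := measurable_pareto_index alpha_gt0.
have [_ /(_ _ _ _ _ _ pn (pareto_rv_symmetric alpha_gt0 0)
  (pareto_rv_regularly_varying alpha_gt0 alpha_lt2 0) (pareto_array_iid alpha_gt0)
  (truncn_mul_cvg_infty gamma_gt0) (truncn_mul_ratio_cvg gamma_gt0)) aeH] := H_heavyMP.
pose W n : set (measurableTypeR R) := [set w | h / 2 * (pn n)%:R <=
  \tr (lorentz u eta (sample_correlation (pn n) n (entries R Z w)))].
have mW n : measurable (W n) by exact: measurable_big_correlation.
have aeW : {ae @unit_lebesgue R, forall w, \forall n \near \oo, W n w}.
  apply: filterS aeH => w /(_ (lorentzian u eta) (lorentzian_continuous eta0)).
  have bb : exists M, forall x, `|lorentzian u eta x| <= M.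
    by exists 1 => x; rewrite ger0_norm ?lorentzian_ge0// lorentzian_le1.
  move=> /(_ bb) cv.
  have hlt : ((h / 2)%:E < \int[H]_x (lorentzian u eta x)%:E)%E.
    apply: (lt_le_trans _ (atom_le_integral_lorentzian _ eta0 H)); rewrite hE lte_fin.
    by rewrite ltr_pdivrMr// ltr_pMr// ltr1n.
  have ev : \forall n \near \oo, ((h / 2)%:E <
      \int[esd (sample_correlation (pn n) n (entries R Z w))]_x (lorentzian u eta x)%:E)%E.
    exact: (cv _ (open_ereal_gt' hlt)).
  apply: filterS ev => n.
  rewrite integral_esd; [|exact: lorentzian_continuous|exact: lorentzian_ge0].
  rewrite -lorentz_trace//; last exact: sample_correlation_sym.
  rewrite lte_fin /W /=; set tr := \tr _.
  (* For [p = 0] the prefactor [0^-1] is 0 by convention, so the integral vanishes and the strict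
     lower bound excludes this case. *)
  have [->|pn0] := eqVneq (pn n) 0%N.
    by rewrite invr0 mul0r => hn; exfalso; move: h0 hn; lra.
  by rewrite [X in _ < X -> _]mulrC ltr_pdivlMr ?ltr0n ?lt0n// => /ltW.
have [N hN] := ae_eventually_half mW aeW.
have [n [m [t [L [kappa [[Nn n0 m0 t0 p0] k0 kL [k1 k2] small]]]]]] := params N.
have := big_correlation_bound alpha_gt0 alpha_lt2 mZ
  (pareto_index_law alpha_gt0) (pareto_index_indep alpha_gt0)
  u_gt0 eta0 k0 m0 t0 n0 kL p0 h0 k1 k2.
(* A probability of at least 1/2 makes the left side at least [h / 8], which exceeds the error by
   [small]. *)
rewrite leNgt => /negP; apply.
apply: (@lt_le_trans _ _ (h / 8)%:E); first by rewrite lte_fin.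
have -> : (h / 8)%:E = ((h / 4)%:E * (2^-1)%:E)%E.
  by rewrite -EFinM; congr EFin; field.
by apply: lee_wpmul2l; [rewrite lee_fin divr_ge0// ltW|exact: hN].
Qed.
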